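(* Let $\{a_n,b_n\}_{n=1}^\infty$ be Jacobi parameters with $$\sum_{n=1}^\infty \bigl(|a_n-1|+|b_n|\bigr)<\infty .$$ Then for every $\varepsilon>0$ there is uniform clock behavior on the interval $[-2+\varepsilon,2-\varepsilon]$.
   Context: Jacobi parameters are bounded sequences $a_n>0$, $b_n\in\mathbb{R}$ ($n\ge 1$). The associated orthonormal polynomials $p_n$ are defined by $p_{-1}=0$, $p_0=1$ and $xp_n(x)=a_{n+1}p_{n+1}(x)+b_{n+1}p_n(x)+a_np_{n-1}(x)$, $n\ge 0$. The zeros of $p_n$ are real and simple; let $\nu_n$ be the probability measure giving weight $1/n$ to each of the $n$ zeros of $p_n$. The density of states exists if $\nu_n$ has a weak limit $\nu$ as $n\to\infty$. (When $a_n\to1$, $b_n\to0$ it is known that it exists and $d\nu=\pi^{-1}(4-x^2)^{-1/2}\chi_{[-2,2]}(x)\,dx$.) There is uniform clock behavior on $[\alpha,\beta]$ if $d\nu/dE$ is continuous and nonvanishing on $[\alpha,\beta]$ and $$\lim_{n\to\infty}\ \sup\Bigl\{\Bigl|\,n|E-E'|-\Bigl(\frac{d\nu}{dE}(E)\Bigr)^{-1}\Bigr| \ :\ E,E'\text{ are successive zeros of }p_n\text{ in }[\alpha,\beta]\Bigr\}=0 .$$ *)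

(* Defs.v *)
From HB Require Import structures.
From mathcomp Require Import all_boot all_order all_algebra.
From mathcomp Require Import polyrcf.
From mathcomp Require Import all_classical all_reals all_analysis.
Import Order.TTheory GRing.Theory Num.Theory.
Import numFieldNormedType.Exports.
Set Implicit Arguments.
Unset Strict Implicit.
Unset Printing Implicit Defensive.

Local Open Scope classical_set_scope.
Local Open Scope ring_scope.

(* Sequences are indexed from 1, so the values a 0 and b 0 are junk. *)
Definition jacobi_parameters (R : realType) (a b : nat -> R) : Prop :=
  (forall n, (0 < n)%N -> 0 < a n) /\
  (exists M : R, forall n, (0 < n)%N -> `|a n| <= M /\ `|b n| <= M).

(* The three-term recurrence solved for its leading term; the inner match is
   p_(n-1), with p_(-1) = 0. *)
Fixpoint orthopoly (R : realType) (a b : nat -> R) (n : nat) : {poly R} :=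
  match n with
  | 0%N => 1
  | m.+1 =>
      (a m.+1)^-1 *:
        (('X - (b m.+1)%:P) * orthopoly a b m
         - a m *: match m with
                  | 0%N => 0
                  | k.+1 => orthopoly a b k
                  end)
  end.

Lemma orthopoly_rec (R : realType) (a b : nat -> R) (n : nat) :
  jacobi_parameters a b ->
  'X * orthopoly a b n.+1 =
    a n.+2 *: orthopoly a b n.+2 + b n.+2 *: orthopoly a b n.+1
    + a n.+1 *: orthopoly a b n.
Proof.
move=> [a_gt0 _].
have an0 : a n.+2 != 0 by rewrite gt_eqF// a_gt0.
rewrite [orthopoly a b n.+2]/= -/(orthopoly a b n.+1) scalerA divff// scale1r.
by rewrite mulrBl mul_polyC addrAC subrK subrK.
Qed.

(* rootsR lists the distinct real roots; p_n with n >= 1 has exactly n. *)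
Definition zero_measure (R : realType) (a b : nat -> R) (n : nat) :
    {measure set (measurableTypeR R) -> \bar R} :=
  let zs := rootsR (orthopoly a b n) in
  mscale (n%:R^-1)%:nng
    (msum (fun k => \d_(zs`_k : measurableTypeR R)) (size zs)).

Definition weak_limit (R : realType)
    (mu_ : nat -> {measure set (measurableTypeR R) -> \bar R})
    (mu : {measure set (measurableTypeR R) -> \bar R}) : Prop :=
  forall f : R -> R, continuous f -> bounded_fun f ->
    (\int[mu_ n]_x (f x)%:E)%E @[n --> \oo] --> (\int[mu]_x (f x)%:E)%E.

Definition density_of_states (R : realType) (a b : nat -> R)
    (nu : probability (measurableTypeR R) R) : Prop :=
  weak_limit (zero_measure a b) nu.

(* rho is a version of d nu / dE on [alpha, beta]; nothing is required of nu
   outside that interval. *)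
Definition density_on (R : realType)
    (nu : {measure set (measurableTypeR R) -> \bar R})
    (alpha beta : R) (rho : R -> R) : Prop :=
  forall A : set (measurableTypeR R), measurable A -> A `<=` `[alpha, beta] ->
    nu A = (\int[@lebesgue_measure R]_(x in A) (rho x)%:E)%E.

(* Either of the two zeros may be the larger one. *)
Definition successive_zeros_in (R : realType) (p : {poly R})
    (alpha beta E E' : R) : Prop :=
  [/\ E \in `[alpha, beta], E' \in `[alpha, beta], root p E, root p E' &
      E != E' /\
      forall x, Num.min E E' < x -> x < Num.max E E' -> ~~ root p x].

Definition clock_deviations (R : realType) (a b : nat -> R) (rho : R -> R)
    (alpha beta : R) (n : nat) : set R :=
  [set d | exists E E' : R,
     successive_zeros_in (orthopoly a b n) alpha beta E E' /\
     d = `| n%:R * `|E - E'| - (rho E)^-1 | ].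

(* The sets of deviations are finite, so the real-valued sup is the genuine
   supremum, except for sup set0 = 0, the right convention for deviations. *)
Definition uniform_clock (R : realType) (a b : nat -> R) (alpha beta : R) :
    Prop :=
  exists (nu : probability (measurableTypeR R) R) (rho : R -> R),
    [/\ density_of_states a b nu,
        density_on nu alpha beta rho,
        {within `[alpha, beta], continuous rho},
        (forall x, x \in `[alpha, beta] -> rho x != 0) &
        sup (clock_deviations a b rho alpha beta n) @[n --> \oo] --> (0 : R)].

(* Main.v *)
From HB Require Import structures.
Require Import Defs.
From mathcomp Require Import all_boot all_order all_algebra.
From mathcomp Require Import polyrcf ring lra.
From mathcomp Require Import all_classical all_reals all_analysis.
From mathcomp Require Import measurable_realfun.
Import Order.TTheory GRing.Theory Num.Theory.
Import numFieldNormedType.Exports.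
Set Implicit Arguments.
Unset Strict Implicit.
Unset Printing Implicit Defensive.
Local Open Scope classical_set_scope.
Local Open Scope ring_scope.

(** Put [x = 2 cos t] with [0 < t < pi]. For [a = 1] and [b = 0] one has
    [p_n (2 cos t) = sin ((n + 1) t) / sin t], whose zeros are equally spaced
    in [t]. A summable perturbation only gives this oscillation an amplitude
    and a phase that converge as [n] grows, locally uniformly in [t], so the
    spacing in [t] is still asymptotically [pi / n]; in [x] it is
    [2 pi sin t / n = pi sqrt (4 - x^2) / n], the inverse of [n] times the
    arcsine density.

    Variation of parameters makes this precise: [sin t] times [p_(n+1)] is
    [A_n sin ((n + 2) t) + B_n cos ((n + 2) t)] and [sin t] times [p_n] is
    [A_n sin ((n + 1) t) + B_n cos ((n + 1) t)], where the vector [(A_n, B_n)]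
    changes from [n] to [n + 1] by at most its own size times a summable
    constant, as long as [sin t] stays away from [0]. A discrete Gronwall
    argument therefore keeps [(A_n, B_n)] within a small relative distance of
    the single continuous nonvanishing function [(A_N, B_N)], and so
    [(A_n, B_n)] is almost constant over distances of order [1 / n]
    ([jost_slow_variation]).

    A sinusoid with almost constant coefficients changes sign on every interval
    slightly longer than half its period, so gaps between zeros are not much
    longer than [pi / n] ([zero_in_gap]). For the reverse bound, the
    Christoffel-Darboux formula shows that [p_n] has opposite signs at two
    successive zeros of [p_(n+1)]; at these zeros [p_n] reads off the amplitude
    of the sinusoid with its phase factor, so the phase must advance by nearly
    an odd multiple of [pi], and the upper bound leaves only [pi]
    ([zero_spacing]).

    The upper bound on gaps also identifies the density of states. Each cell of
    length about [pi / n] contains a zero, which bounds the averages of a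
    nonnegative function over the zeros from below by its integral against the
    arcsine law ([zero_average_liminf]). As [p_n] has at most [n] zeros, the
    averages have total mass at most [1], so the same bound applied to [M + f]
    and [M - f] forces the averages of [f] to converge
    ([arcsine_density_of_states]). *)

(** * Orthogonal polynomials and the interlacing of their zeros *)

Arguments orthopoly : simpl never.

Lemma orthopolyS_rec (R : realType) (a b : nat -> R) (n : nat) :
  jacobi_parameters a b ->
  a n.+2 *: orthopoly a b n.+2 =
    ('X - (b n.+2)%:P) * orthopoly a b n.+1 - a n.+1 *: orthopoly a b n.
Proof.
move=> hJ; rewrite mulrBl orthopoly_rec// mul_polyC.
by rewrite addrAC addrK addrK.
Qed.

Lemma orthopoly_horner_rec (R : realType) (a b : nat -> R) (n : nat) (x : R) :
  jacobi_parameters a b ->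
  a n.+2 * (orthopoly a b n.+2).[x] =
    (x - b n.+2) * (orthopoly a b n.+1).[x] - a n.+1 * (orthopoly a b n).[x].
Proof. by move=> hJ; rewrite -hornerZ orthopolyS_rec// !hornerE. Qed.

(** The diagonal case of the Christoffel-Darboux formula. Differentiating the
    recurrence and eliminating [x] shows that the left-hand side grows by
    [p_n ^ 2] at each step. *)
Lemma christoffel_darboux (R : realType) (a b : nat -> R) (n : nat) :
  jacobi_parameters a b ->
  a n.+1 *: ((orthopoly a b n.+1)^`() * orthopoly a b n -
             orthopoly a b n.+1 * (orthopoly a b n)^`()) =
  \sum_(k < n.+1) orthopoly a b k ^+ 2.
Proof.
move=> hJ; elim: n => [|n IH].
  rewrite big_ord_recl big_ord0 /orthopoly expr1n addr0.
  rewrite scaler0 subr0 !mulr1 derivC mulr0 subr0 derivZ derivB.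
  rewrite [X in X - _]derivX derivC subr0.
  by rewrite scalerA divff ?scale1r// gt_eqF// hJ.1.
rewrite big_ord_recr -IH scalerBr !scalerAl -derivZ orthopolyS_rec//.
move: (orthopoly a b n.+1) (orthopoly a b n) => p q.
rewrite derivB derivM derivZ derivB derivX derivC subr0 mul1r -!mul_polyC.
rewrite /=; ring.
Qed.

(** Both the simplicity of the zeros and their interlacing follow from this
    positivity; it also shows that [p_n] and [p_(n+1)] never vanish together. *)
Lemma wronskian_gt0 (R : realType) (a b : nat -> R) (n : nat) (x : R) :
  jacobi_parameters a b ->
  0 < (orthopoly a b n.+1)^`().[x] * (orthopoly a b n).[x] -
      (orthopoly a b n.+1).[x] * (orthopoly a b n)^`().[x].
Proof.
move=> hJ; rewrite -(pmulr_rgt0 _ (hJ.1 n.+1 isT)).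
have := congr1 (horner^~ x) (christoffel_darboux n hJ).
rewrite hornerZ hornerD hornerN !hornerM => ->.
rewrite horner_sum big_ord_recl horner_exp.
rewrite /= hornerC expr1n ltr_pwDl// sumr_ge0// => i _.
by rewrite horner_exp sqr_ge0.
Qed.

Lemma orthopoly_neq0 (R : realType) (a b : nat -> R) (n : nat) :
  jacobi_parameters a b -> orthopoly a b n != 0.
Proof.
move=> hJ; case: n => [|n]; first exact: oner_neq0.
apply/eqP => p0; have := wronskian_gt0 n 0 hJ.
by rewrite p0 deriv0 !horner0 !mul0r subrr ltxx.
Qed.

Lemma size_orthopoly (R : realType) (a b : nat -> R) (n : nat) :
  (size (orthopoly a b n) <= n.+1)%N.
Proof.
suff: (size (orthopoly a b n) <= n.+1)%N /\
      (size (orthopoly a b n.+1) <= n.+2)%N by case.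
have step m (q : {poly R}) :
    (size (orthopoly a b m) <= m.+1)%N -> (size q <= m.+2)%N ->
    (size ((a m.+1)^-1 *: (('X - (b m.+1)%:P) * orthopoly a b m - a m *: q))
     <= m.+2)%N.
  move=> hp hq; apply: leq_trans (size_scale_leq _ _) _.
  apply: leq_trans (size_polyD _ _) _; rewrite geq_max size_polyN.
  rewrite (leq_trans (size_scale_leq _ _) hq) andbT.
  apply: leq_trans (size_polyMleq _ _) _.
  by rewrite size_XsubC.
elim: n => [|n [h1 h2]]; last first.
  by split => //; exact: (step n.+1 _ h2 (leqW (leqW h1))).
have h0 : (size (orthopoly a b 0) <= 1)%N by rewrite size_poly1.
by split => //; apply: (step 0 0 h0); rewrite size_poly0.
Qed.

(** After dividing out the two roots [x] and [y], the cofactor has no sign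
    change on [[x, y]], and the derivatives at [x] and [y] are the cofactor
    times [x - y] and [y - x]. *)
Lemma deriv_opposite_signs (R : realType) (p : {poly R}) (x y : R) :
  x < y -> root p x -> root p y ->
  (forall z, x < z -> z < y -> ~~ root p z) ->
  p^`().[x] != 0 -> p^`().[y] != 0 -> p^`().[x] * p^`().[y] < 0.
Proof.
move=> xy /factor_theorem[q ->].
rewrite rootM root_XsubC [y == x]gt_eqF// orbF => /factor_theorem[{}q ->].
move=> nor; rewrite !derivM !derivXsubC !hornerE.
rewrite !subrr !mulr0 !addr0 !add0r => /[!mulf_eq0] /[!negb_or].
move=> /andP[qx _] /andP[qy _].
have qq : 0 < q.[x] * q.[y].
  rewrite ltNge le_eqVlt mulf_eq0 (negbTE qx) (negbTE qy)/=.
  apply/negP => /(poly_ivtoo (ltW xy))[z /[!in_itv]/= /andP[xz zy] qz].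
  by have := nor z xz zy; rewrite !rootM qz.
rewrite mulrACA pmulr_rlt0//.
by rewrite nmulr_rlt0 ?subr_lt0// subr_gt0.
Qed.

(** At a zero of [p_(n+1)] the Wronskian is [p_(n+1)' p_n], so [p_n] has the
    sign of [p_(n+1)'] there, and that sign alternates along the zeros. *)
Lemma orthopoly_interlace (R : realType) (a b : nat -> R) (n : nat) (x y : R) :
  jacobi_parameters a b ->
  x < y -> root (orthopoly a b n.+1) x -> root (orthopoly a b n.+1) y ->
  (forall z, x < z -> z < y -> ~~ root (orthopoly a b n.+1) z) ->
  (orthopoly a b n).[x] * (orthopoly a b n).[y] < 0.
Proof.
move=> hJ xy rx ry nor.
have := wronskian_gt0 n x hJ; have := wronskian_gt0 n y hJ.
rewrite (rootP rx) (rootP ry) !mul0r !subr0 => Wy Wx.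
have dx : (orthopoly a b n.+1)^`().[x] != 0.
  by apply: contraTneq Wx => ->; rewrite mul0r ltxx.
have dy : (orthopoly a b n.+1)^`().[y] != 0.
  by apply: contraTneq Wy => ->; rewrite mul0r ltxx.
have dd := deriv_opposite_signs xy rx ry nor dx dy.
by have := mulr_gt0 Wx Wy; rewrite mulrACA nmulr_rgt0.
Qed.

(** * Variation of parameters *)

Definition polycos (R : realType) (a b : nat -> R) (n : nat) (t : R) : R :=
  (orthopoly a b n).[2 * cos t].

(** [jostA] and [jostB] are the real and imaginary parts of
    [exp (-i (n + 1) t) (p_(n+1) - exp (-i t) p_n)], the finite-[n] version of
    the Jost function. They are independent of [n] in the free case. *)
Definition jostA (R : realType) (a b : nat -> R) (n : nat) (t : R) : R :=
  cos (n.+1%:R * t) * polycos a b n.+1 t - cos (n.+2%:R * t) * polycos a b n t.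

Definition jostB (R : realType) (a b : nat -> R) (n : nat) (t : R) : R :=
  sin (n.+2%:R * t) * polycos a b n t - sin (n.+1%:R * t) * polycos a b n.+1 t.

Definition jost_norm (R : realType) (a b : nat -> R) (n : nat) (t : R) : R :=
  `|jostA a b n t| + `|jostB a b n t|.

(** The amount by which [p_n (2 cos t)] fails to solve the free recurrence. *)
Definition recurrence_defect (R : realType) (a b : nat -> R) (n : nat) (t : R)
    : R :=
  polycos a b n.+2 t + polycos a b n t - 2 * cos t * polycos a b n.+1 t.

Lemma sin_addfreq (R : realType) (n : nat) (t : R) :
  sin (n.+1%:R * t) = sin (n%:R * t) * cos t + cos (n%:R * t) * sin t.
Proof. by rewrite -natr1 mulrDl mul1r sinD. Qed.

Lemma cos_addfreq (R : realType) (n : nat) (t : R) :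
  cos (n.+1%:R * t) = cos (n%:R * t) * cos t - sin (n%:R * t) * sin t.
Proof. by rewrite -natr1 mulrDl mul1r cosD. Qed.

(** Together with [sin_polycos], this inverts the definition of the pair
    [(jostA, jostB)]: the change of basis has determinant [sin t]. *)
Lemma sin_polycosS (R : realType) (a b : nat -> R) (n : nat) (t : R) :
  sin t * polycos a b n.+1 t =
  jostA a b n t * sin (n.+2%:R * t) + jostB a b n t * cos (n.+2%:R * t).
Proof.
rewrite /jostA /jostB (sin_addfreq n.+1) (cos_addfreq n.+1).
have := cos2Dsin2 (n.+1%:R * t).
move: (cos (n.+1%:R * t)) (sin (n.+1%:R * t)) => c s h.
set P := polycos a b n.+1 t; set Q := polycos a b n t.
transitivity ((c ^+ 2 + s ^+ 2) * (sin t * P)); first by rewrite h mul1r.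
by ring.
Qed.

Lemma sin_polycos (R : realType) (a b : nat -> R) (n : nat) (t : R) :
  sin t * polycos a b n t =
  jostA a b n t * sin (n.+1%:R * t) + jostB a b n t * cos (n.+1%:R * t).
Proof.
rewrite /jostA /jostB (sin_addfreq n.+1) (cos_addfreq n.+1).
have := cos2Dsin2 (n.+1%:R * t).
move: (cos (n.+1%:R * t)) (sin (n.+1%:R * t)) => c s h.
set P := polycos a b n.+1 t; set Q := polycos a b n t.
transitivity ((c ^+ 2 + s ^+ 2) * (sin t * Q)); first by rewrite h mul1r.
by ring.
Qed.

(** The free recurrence is solved by [cos ((n + 2) t)] and [sin ((n + 2) t)], so
    in the increments of [jostA] and [jostB] only the defect survives. *)
Lemma jostA_step (R : realType) (a b : nat -> R) (n : nat) (t : R) :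
  jostA a b n.+1 t - jostA a b n t =
  cos (n.+2%:R * t) * recurrence_defect a b n t.
Proof.
rewrite /jostA /recurrence_defect (cos_addfreq n.+2).
rewrite (_ : cos (n.+1%:R * t) =
   cos (n.+2%:R * t) * cos t + sin (n.+2%:R * t) * sin t); first by ring.
by rewrite -cosB -(natr1 n.+1) mulrDl mul1r addrK.
Qed.

Lemma jostB_step (R : realType) (a b : nat -> R) (n : nat) (t : R) :
  jostB a b n.+1 t - jostB a b n t =
  - sin (n.+2%:R * t) * recurrence_defect a b n t.
Proof.
rewrite /jostB /recurrence_defect (sin_addfreq n.+2).
rewrite (_ : sin (n.+1%:R * t) =
   sin (n.+2%:R * t) * cos t - cos (n.+2%:R * t) * sin t); first by ring.
by rewrite -sinB -(natr1 n.+1) mulrDl mul1r addrK.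
Qed.

Lemma recurrence_defectE (R : realType) (a b : nat -> R) (n : nat) (t : R) :
  jacobi_parameters a b ->
  recurrence_defect a b n t =
  (1 - a n.+2) * polycos a b n.+2 t - b n.+2 * polycos a b n.+1 t
  + (1 - a n.+1) * polycos a b n t.
Proof.
move=> hJ; have := orthopoly_horner_rec n (2 * cos t) hJ.
rewrite -/(polycos a b n.+2 t) -/(polycos a b n.+1 t) -/(polycos a b n t).
by rewrite /recurrence_defect; lra.
Qed.

Definition perturbation (R : realType) (a b : nat -> R) (n : nat) : R :=
  `|a n - 1| + `|b n|.

(** The defect involves [p_(n+2)], which is itself the defect plus terms in
    [p_(n+1)] and [p_n]; once the perturbation is at most one half, the defect
    can be absorbed on the left. *)
Lemma recurrence_defect_le (R : realType) (a b : nat -> R) (n : nat) (t : R) :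
  jacobi_parameters a b -> perturbation a b n.+2 <= 2^-1 ->
  `|recurrence_defect a b n t| <=
  4 * (perturbation a b n.+1 + perturbation a b n.+2) *
    (`|polycos a b n.+1 t| + `|polycos a b n t|).
Proof.
move=> hJ; have := recurrence_defectE n t hJ.
have : polycos a b n.+2 t = recurrence_defect a b n t
   + 2 * cos t * polycos a b n.+1 t - polycos a b n t.
  by rewrite /recurrence_defect; lra.
have : `|cos t| <= 1 by rewrite ler_norml cos_geN1 cos_le1.
rewrite /perturbation (distrC _ 1) (distrC _ 1).
move: (recurrence_defect a b n t) (polycos a b n.+2 t) => r p2.
move: (polycos a b n.+1 t) (polycos a b n t) (cos t) => p1 p0 c hc p2E rE.
move: (1 - a n.+2) (1 - a n.+1) (b n.+2) (b n.+1) rE => x y z z' rE hx.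
have p2le : `|p2| <= `|r| + 2 * `|p1| + `|p0|.
  rewrite p2E; apply: le_trans (ler_normB _ _) _; rewrite lerD2r.
  apply: le_trans (ler_normD _ _) _; rewrite lerD2l !normrM (ger0_norm (ltW _))//.
  have := normr_ge0 p1; have := normr_ge0 c; nra.
have rle : `|r| <= `|x| * `|p2| + `|z| * `|p1| + `|y| * `|p0|.
  rewrite rE -!normrM; apply: le_trans (ler_normD _ _) _; rewrite lerD2r.
  exact: ler_normB.
move: hx p2le rle (normr_ge0 x) (normr_ge0 y) (normr_ge0 z) (normr_ge0 z').
move: (normr_ge0 p1) (normr_ge0 p0) (normr_ge0 r).
move: `|x| `|y| `|z| `|z'| `|p1| `|p0| `|r| `|p2| => X Y Z W P1 P0 r' P2.
move=> h1 h0 hr hXZ h2 hrle hX hY hZ hW.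
have : X * P2 <= X * (r' + 2 * P1 + P0) by exact: ler_wpM2l.
have : X * r' <= 2^-1 * r' by apply: ler_wpM2r => //; lra.
have : 0 <= X * P1 by exact: mulr_ge0.
have : 0 <= X * P0 by exact: mulr_ge0.
have : 0 <= Y * P1 by exact: mulr_ge0.
have : 0 <= Y * P0 by exact: mulr_ge0.
have : 0 <= Z * P1 by exact: mulr_ge0.
have : 0 <= Z * P0 by exact: mulr_ge0.
have : 0 <= W * P1 by exact: mulr_ge0.
have : 0 <= W * P0 by exact: mulr_ge0.
move=> *; lra.
Qed.

(** * Summability of the perturbation and the Gronwall argument *)

Lemma jost_norm_ge0 (R : realType) (a b : nat -> R) (n : nat) (t : R) :
  0 <= jost_norm a b n t.
Proof. by rewrite addr_ge0. Qed.

Lemma phase_comb_le (R : realType) (A B x : R) :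
  `|A * sin x + B * cos x| <= `|A| + `|B|.
Proof.
have hs : `|sin x| <= 1 by rewrite ler_norml sin_geN1 sin_le1.
have hc : `|cos x| <= 1 by rewrite ler_norml cos_geN1 cos_le1.
apply: le_trans (ler_normD _ _) _; rewrite !normrM.
by apply: lerD; apply: ler_piMr.
Qed.

(** Dividing by [sin t] recovers the sizes of [p_(n+1)] and [p_n] from the
    amplitude vector, which closes the estimate of [recurrence_defect_le]. *)
Lemma jost_step_le (R : realType) (a b : nat -> R) (n : nat) (s t : R) :
  jacobi_parameters a b -> 0 < s -> s <= sin t ->
  perturbation a b n.+2 <= 2^-1 ->
  `|jostA a b n.+1 t - jostA a b n t| + `|jostB a b n.+1 t - jostB a b n t| <=
  16 / s * (perturbation a b n.+1 + perturbation a b n.+2) * jost_norm a b n t.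
Proof.
move=> hJ s0 st hp; rewrite jostA_step jostB_step !normrM normrN.
have hr := recurrence_defect_le t hJ hp.
have hs : `|sin (n.+2%:R * t)| <= 1 by rewrite ler_norml sin_geN1 sin_le1.
have hc : `|cos (n.+2%:R * t)| <= 1 by rewrite ler_norml cos_geN1 cos_le1.
set r := `|recurrence_defect a b n t|.
have r0 : 0 <= r by exact: normr_ge0.
apply: (@le_trans _ _ (r + r)).
  by apply: lerD; apply: ler_piMl.
have inv y : `|sin t * y| <= jost_norm a b n t -> `|y| <= jost_norm a b n t / s.
  rewrite normrM => h; rewrite ler_pdivlMr// mulrC; apply: le_trans h.
  apply: ler_wpM2r => //; exact: le_trans st (ler_norm _).
have h1 : `|polycos a b n.+1 t| <= jost_norm a b n t / s.
  by apply: inv; rewrite sin_polycosS phase_comb_le.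
have h0 : `|polycos a b n t| <= jost_norm a b n t / s.
  by apply: inv; rewrite sin_polycos phase_comb_le.
set E := _ + perturbation a b n.+2 in hr *.
have E0 : 0 <= E by rewrite !addr_ge0.
have : E * (`|polycos a b n.+1 t| + `|polycos a b n t|) <=
       E * (jost_norm a b n t / s + jost_norm a b n t / s).
  by apply: ler_wpM2l => //; exact: lerD.
rewrite (_ : 16 / s * E * jost_norm a b n t =
  16 * (E * (jost_norm a b n t / s))); last by ring.
move: hr; rewrite -/r -mulrA mulrDr mulrDr; lra.
Qed.

(** Discrete Gronwall inequality in relative form. As long as the partial sum
    [S] of the constants is at most one half, the bound [2 S] on the relative
    displacement reproduces itself, because the vector has then at most doubled
    in size. *)
Lemma relative_cauchy (R : realType) (u v e : nat -> R) (N : nat) (k : R) :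
  k <= 2^-1 -> (forall n, 0 <= e n) ->
  (forall n, \sum_(N <= i < n) e i <= k) ->
  (forall n, (N <= n)%N ->
     `|u n.+1 - u n| + `|v n.+1 - v n| <= e n * (`|u n| + `|v n|)) ->
  forall n, (N <= n)%N ->
    `|u n - u N| + `|v n - v N| <= 2 * k * (`|u N| + `|v N|).
Proof.
move=> k2 e0 ek step n Nn.
set U := `|u N| + `|v N|; have U0 : 0 <= U by rewrite addr_ge0.
suff: `|u n - u N| + `|v n - v N| <= 2 * (\sum_(N <= i < n) e i) * U.
  move=> h; apply: le_trans h _; apply: ler_wpM2r => //.
  by apply: ler_wpM2l => //; exact: ek.
rewrite -(subnKC Nn); elim: (n - N)%N => [|m IH].
  by rewrite addn0 !subrr normr0 addr0 big_geq// mulr0 mul0r.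
rewrite addnS big_nat_recr/= ?leq_addr//.
have := step (N + m)%N (leq_addr _ _).
have := ek (N + m)%N; move: IH; set S := \sum_(_ <= _ < _) _ => IH Sk.
have S0 : 0 <= S by apply: sumr_ge0.
have h1 : `|u (N + m)%N| <= `|u (N + m)%N - u N| + `|u N|.
  by rewrite -[X in `|X| <= _](subrK (u N)) ler_normD.
have h2 : `|v (N + m)%N| <= `|v (N + m)%N - v N| + `|v N|.
  by rewrite -[X in `|X| <= _](subrK (v N)) ler_normD.
have h3 := ler_distD (u (N + m)%N) (u (N + m).+1) (u N).
have h4 := ler_distD (v (N + m)%N) (v (N + m).+1) (v N).
have SU : S * U <= 2^-1 * U by apply: ler_wpM2r => //; lra.
have : e (N + m)%N * (`|u (N + m)%N| + `|v (N + m)%N|) <= e (N + m)%N * (2 * U).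
  by apply: ler_wpM2l => //; rewrite /U in SU IH *; lra.
rewrite mulrDr mulrDl; lra.
Qed.

Lemma perturbation_ge0 (R : realType) (a b : nat -> R) (n : nat) :
  0 <= perturbation a b n.
Proof. by rewrite addr_ge0. Qed.

Lemma perturbation_tail (R : realType) (a b : nat -> R) (k : R) :
  (\sum_(1 <= n <oo) (`|a n - 1| + `|b n|)%:E < +oo)%E -> 0 < k ->
  exists N, forall m n, (N <= m)%N -> \sum_(m <= i < n) perturbation a b i <= k.
Proof.
move=> hsum k0; pose f n := (perturbation a b n)%:E.
have f0 n : true -> (0 <= f n)%E by move=> _; rewrite lee_fin perturbation_ge0.
have : (\sum_(0 <= n <oo) f n < +oo)%E.
  rewrite nneseries_recl//; apply: lte_add_pinfty => //.
  by rewrite /f ltry.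
move=> /nneseries_tail_cvg /(_ (fun n => f0 n)) h.
have /fine_cvgP[fin] : (\sum_(N <= i <oo) f i)%E @[N --> \oo] --> 0%:E by exact: h.
move=> /cvgrPdist_lt /(_ k k0) lt; have [N _ hN] := filterI fin lt.
exists N => m n Nm; have [/= fm] := hN m Nm; rewrite sub0r normrN => ltm.
rewrite -lee_fin -sumEFin; apply: (@le_trans _ _ (\sum_(m <= i <oo) f i)%E).
  by apply: nneseries_lim_ge => i _ _; exact: f0.
by rewrite -(fineK fm) lee_fin (le_trans (ler_norm _))// ltW.
Qed.

(** * Slow variation of the amplitude vector *)

(** The index [N] does not depend on [t], only on the lower bound [s] for
    [sin t]; this uniformity is what transfers the continuity of the one function
    [(A_N, B_N)] to all later ones. *)
Lemma jost_relative_cauchy (R : realType) (a b : nat -> R) (s k : R) :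
  jacobi_parameters a b ->
  (\sum_(1 <= n <oo) (`|a n - 1| + `|b n|)%:E < +oo)%E -> 0 < s -> 0 < k ->
  exists N, forall n t, (N <= n)%N -> s <= sin t ->
    `|jostA a b n t - jostA a b N t| + `|jostB a b n t - jostB a b N t| <=
    k * jost_norm a b N t.
Proof.
move=> hJ hsum s0 k0.
pose k' := Num.min (k / 2) 2^-1.
have k'0 : 0 < k' by rewrite lt_min divr_gt0//= invr_gt0.
have k'k : 2 * k' <= k by rewrite -ler_pdivlMl// mulrC ge_min lexx.
have k'2 : k' <= 2^-1 by rewrite ge_min lexx orbT.
pose q := Num.min (k' * s / 32) 2^-1.
have q0 : 0 < q by rewrite lt_min !divr_gt0 ?mulr_gt0//= invr_gt0.
have [N hN] := perturbation_tail hsum q0.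
exists N => n t Nn st.
pose e i := 16 / s * (perturbation a b i.+1 + perturbation a b i.+2).
have e0 i : 0 <= e i.
  by rewrite mulr_ge0 ?addr_ge0 ?perturbation_ge0// divr_ge0// ltW.
apply: le_trans (_ : 2 * k' * jost_norm a b N t <= _); last first.
  by apply: ler_wpM2r => //; exact: jost_norm_ge0.
apply: (@relative_cauchy R (jostA a b ^~ t) (jostB a b ^~ t) e N k') => //.
- move=> m; rewrite -big_distrr/= big_split/=.
  have h1 : \sum_(N <= i < m) perturbation a b i.+1 <= q.
    by rewrite -(big_add1 _ _ _ m.+1 xpredT); exact: hN.
  have h2 : \sum_(N <= i < m) perturbation a b i.+2 <= q.
    rewrite -(big_add1 _ _ _ m.+1 xpredT (fun i => perturbation a b i.+1)).
    by rewrite -(big_add1 _ _ _ m.+2 xpredT); exact: (hN _ _ (leqW (leqW _))).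
  have h3 : q <= k' * s / 32 by rewrite ge_min lexx.
  rewrite mulrAC ler_pdivrMr//; lra.
- move=> m Nm; apply: jost_step_le => //.
  have := hN m.+2 m.+3 (leqW (leqW Nm)); rewrite big_nat1 => h.
  by apply: (le_trans h); rewrite ge_min lexx orbT.
Qed.

Lemma jost_norm_gt0 (R : realType) (a b : nat -> R) (n : nat) (t : R) :
  jacobi_parameters a b -> sin t != 0 -> 0 < jost_norm a b n t.
Proof.
move=> hJ st; rewrite lt_neqAle jost_norm_ge0 andbT; apply/eqP => h.
have : jostA a b n t == 0 /\ jostB a b n t == 0.
  have /eqP := esym h; rewrite paddr_eq0// !normr_eq0 => /andP[-> ->] //.
move=> [/eqP A0 /eqP B0].
have := sin_polycosS a b n t; have := sin_polycos a b n t.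
rewrite A0 B0 !mul0r addr0 => /eqP; rewrite mulf_eq0 (negbTE st)/= => /eqP p0.
move=> /eqP; rewrite mulf_eq0 (negbTE st)/= => /eqP p1.
have := wronskian_gt0 n (2 * cos t) hJ.
by rewrite -/(polycos a b n t) -/(polycos a b n.+1 t) p0 p1 mulr0 mul0r subrr ltxx.
Qed.

Lemma continuous_polycos (R : realType) (a b : nat -> R) (n : nat) :
  continuous (polycos a b n).
Proof.
move=> t; apply: (@continuous_comp _ _ _ (fun t => 2 * cos t) (horner _)).
  by apply: continuousM; [exact: cvg_cst|exact: continuous_cos].
exact: continuous_horner.
Qed.

Lemma continuous_cosM (R : realType) (c : R) : continuous (fun t => cos (c * t)).
Proof.
move=> t; apply: (@continuous_comp _ _ _ (fun t => c * t) cos).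
  by apply: continuousM; [exact: cvg_cst|exact: cvg_id].
exact: continuous_cos.
Qed.

Lemma continuous_sinM (R : realType) (c : R) : continuous (fun t => sin (c * t)).
Proof.
move=> t; apply: (@continuous_comp _ _ _ (fun t => c * t) sin).
  by apply: continuousM; [exact: cvg_cst|exact: cvg_id].
exact: continuous_sin.
Qed.

Lemma continuous_jostA (R : realType) (a b : nat -> R) (n : nat) :
  continuous (jostA a b n).
Proof.
move=> t; rewrite /continuous_at /jostA; apply: cvgB; apply: cvgM.
- exact: continuous_cosM.
- exact: continuous_polycos.
- exact: continuous_cosM.
- exact: continuous_polycos.
Qed.

Lemma continuous_jostB (R : realType) (a b : nat -> R) (n : nat) :
  continuous (jostB a b n).
Proof.
move=> t; rewrite /continuous_at /jostB; apply: cvgB; apply: cvgM.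
- exact: continuous_sinM.
- exact: continuous_polycos.
- exact: continuous_sinM.
- exact: continuous_polycos.
Qed.

(** Heine-Cantor on a segment. Only the first point has to lie in the segment,
    since [f] is continuous everywhere. *)
Lemma segment_uniformly_continuous (R : realType) (f : R -> R) (c d e : R) :
  continuous f -> 0 < e ->
  exists2 r : R, 0 < r & forall x y, x \in `[c, d] -> `|x - y| < r ->
    `|f x - f y| < e.
Proof.
move=> cf e0.
have /compact_near_coveringP cover := @segment_compact R c d.
have : \forall r \near 0^'+, `[c, d] `<=`
    (fun x => forall y, `|x - y| < r -> `|f x - f y| < e).
  apply: cover => x _; have e2 : 0 < e / 2 by rewrite divr_gt0.
  have /cvgrPdist_lt /(_ _ e2) := cf x.
  move=> /nbhs_ballP[r /= r0 hr].
  exists (ball x (r / 2), [set s | s < r / 2]) => /=.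
    split; first by apply: nbhsx_ballx; rewrite divr_gt0.
    by apply: nbhs_right_lt; rewrite divr_gt0.
  move=> [x' s] [/= xx' sr] y x'y.
  rewrite (splitr e); apply: le_lt_trans (ler_distD (f x) _ _) _.
  rewrite distrC ltrD//; apply: hr; rewrite /ball/=.
    move: xx'; rewrite /ball/= => /lt_le_trans; apply.
    by rewrite ler_pdivrMr// ler_peMr ?ler1n// ltW.
  rewrite (splitr r); apply: le_lt_trans (ler_distD x' _ _) _.
  by rewrite ltrD// (lt_trans x'y).
move=> h; have [r [r0 hr]] := filter_ex (filterI (nbhs_right_gt 0) h).
by exists r => // x y xI xy; exact: hr.
Qed.

(** Compare [(A_n, B_n)] at [t] and at [t'] with [(A_N, B_N)] at the same points:
    the two comparisons cost a small relative error by [jost_relative_cauchy],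
    and [(A_N, B_N)] is uniformly continuous with norm bounded below on the
    segment, so its own variation over a distance of order [1 / n] is also a
    small relative error. *)
Lemma jost_slow_variation (R : realType) (a b : nat -> R) (d s k L : R) :
  jacobi_parameters a b ->
  (\sum_(1 <= n <oo) (`|a n - 1| + `|b n|)%:E < +oo)%E ->
  d <= pi - d -> (forall t, t \in `[d, pi - d] -> s <= sin t) ->
  0 < s -> 0 < k -> 0 < L ->
  exists M, forall n t t', (M <= n)%N -> t \in `[d, pi - d] ->
    t' \in `[d, pi - d] -> `|t - t'| <= L / n.+2%:R ->
    `|jostA a b n t' - jostA a b n t| + `|jostB a b n t' - jostB a b n t| <=
    k * jost_norm a b n t.
Proof.
move=> hJ hsum dd ds s0 k0 L0.
pose q := Num.min (k / 8) 2^-1.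
have q0 : 0 < q by rewrite lt_min divr_gt0//= invr_gt0.
have qk : q <= k / 8 by rewrite ge_min lexx.
have q2 : q <= 2^-1 by rewrite ge_min lexx orbT.
have [N hN] := jost_relative_cauchy hJ hsum s0 q0.
have cJ : continuous (jost_norm a b N).
  move=> t; rewrite /continuous_at /jost_norm; apply: cvgD; apply: cvg_norm.
    exact: continuous_jostA.
  exact: continuous_jostB.
have [c cI cmin] := EVT_min dd (continuous_subspaceT cJ).
have m0 : 0 < jost_norm a b N c.
  by apply: jost_norm_gt0 => //; rewrite gt_eqF// (lt_le_trans s0)// ds.
set m := jost_norm a b N c in cmin m0.
have e0 : 0 < q * m / 2 by rewrite divr_gt0// mulr_gt0.
have [r1 r10 h1] := @segment_uniformly_continuous R (jostA a b N) d (pi - d)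
  _ (@continuous_jostA R a b N) e0.
have [r2 r20 h2] := @segment_uniformly_continuous R (jostB a b N) d (pi - d)
  _ (@continuous_jostB R a b N) e0.
pose r := Num.min r1 r2; have r0 : 0 < r by rewrite lt_min r10.
exists (maxn N (Num.truncn (L / r))) => n t t'; rewrite geq_max => /andP[Nn Ln].
move=> tI t'I tt'.
have tt'r : `|t' - t| < r.
  rewrite distrC; apply: le_lt_trans tt' _.
  rewrite ltr_pdivrMr// mulrC -ltr_pdivrMr//.
  apply: lt_le_trans (truncnS_gt _) _.
  by rewrite ler_nat ltnS (leq_trans Ln).
have tt1 : `|t' - t| < r1 by apply: lt_le_trans tt'r _; rewrite ge_min lexx.
have tt2 : `|t' - t| < r2 by apply: lt_le_trans tt'r _; rewrite ge_min lexx orbT.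
have hA := h1 t' t t'I tt1; have hB := h2 t' t t'I tt2.
have ct := hN n t Nn (ds t tI); have ct' := hN n t' Nn (ds t' t'I).
have mt := cmin t tI.
have {}hA : `|jostA a b N t' - jostA a b N t| +
  `|jostB a b N t' - jostB a b N t| <= q * jost_norm a b N t.
  have : q * m <= q * jost_norm a b N t by rewrite ler_wpM2l// ltW.
  by move: hA hB; lra.
have triang (x y z w : R) : `|x - w| <= `|x - y| + `|y - z| + `|w - z|.
  rewrite [`|w - z|]distrC; apply: le_trans (ler_distD z _ _) _.
  by rewrite lerD2r; exact: ler_distD.
have TA := triang (jostA a b n t') (jostA a b N t') (jostA a b N t) (jostA a b n t).
have TB := triang (jostB a b n t') (jostB a b N t') (jostB a b N t) (jostB a b n t).
have J0 : 0 <= jost_norm a b N t by exact: jost_norm_ge0.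
have low (x y : R) : `|x| <= `|y| + `|y - x|.
  by rewrite -{1}[x](subKr y) ler_normB.
have low' (x y : R) : `|x| <= `|y| + `|x - y| by rewrite distrC.
have NtA := low (jostA a b N t) (jostA a b n t).
have NtB := low (jostB a b N t) (jostB a b n t).
have NtA' := low' (jostA a b N t') (jostA a b N t).
have NtB' := low' (jostB a b N t') (jostB a b N t).
have e1 : jost_norm a b n t = `|jostA a b n t| + `|jostB a b n t| by [].
have e2 : jost_norm a b N t = `|jostA a b N t| + `|jostB a b N t| by [].
have e3 : jost_norm a b N t' = `|jostA a b N t'| + `|jostB a b N t'| by [].
have Jt' : jost_norm a b N t' <= (1 + q) * jost_norm a b N t by lra.
have Jt : jost_norm a b N t <= 2 * jost_norm a b n t.
  have : q * jost_norm a b N t <= 2^-1 * jost_norm a b N t by rewrite ler_wpM2r.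
  by lra.
have : q * jost_norm a b N t' <= q * ((1 + q) * jost_norm a b N t).
  by rewrite ler_wpM2l// ltW.
have : q * q * jost_norm a b N t <= q * jost_norm a b N t.
  by rewrite ler_wpM2r// ler_piMl//; [rewrite ltW|lra].
have : q * jost_norm a b N t <= k / 8 * (2 * jost_norm a b n t).
  by apply: ler_pM => //; rewrite ltW.
by move: TA TB ct ct'; lra.
Qed.

(** * Spacing of the zeros in the angle variable *)

Lemma sin_ge_bulk (R : realType) (d t : R) :
  0 <= d -> t \in `[d, pi - d] -> sin d <= sin t.
Proof.
move=> d0; rewrite in_itv/= => /andP[dt td].
have pi0 := @pi_gt0 R.
rewrite leNgt; apply/negP; rewrite -!cosBpihalf.
have -> : cos (d - pi / 2) = cos (pi / 2 - d) by rewrite -cosN opprB.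
have -> : cos (t - pi / 2) = cos `|t - pi / 2|.
  by have [//|_] := ger0P (t - pi / 2); rewrite cosN.
have hd : `|t - pi / 2| <= pi / 2 - d by rewrite ler_norml; lra.
rewrite ltr_cos ?in_itv/= ?normr_ge0/=; last 2 first.
- by lra.
- by lra.
by move=> /lt_le_trans/(_ hd); rewrite ltxx.
Qed.

Lemma sign_change_zero (R : realType) (f : R -> R) (x y : R) :
  continuous f -> x <= y -> f x * f y <= 0 ->
  exists2 z, z \in `[x, y] & f z = 0.
Proof.
move=> cf xy fxy; apply: (IVT xy (continuous_subspaceT cf)).
rewrite ge_min le_max; apply: contraTT fxy => nI; rewrite -ltNge.
have [fx|fx] := leP (f x) 0; have [fy|fy] := leP (f y) 0; last exact: mulr_gt0.
- have x0 : f x < 0.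
    by rewrite ltNge; apply: contraNN nI => ->; rewrite fx.
  have y0 : f y < 0.
    by rewrite ltNge; apply: contraNN nI => ->; rewrite fx orbT.
  by rewrite nmulr_rgt0.
- by move: nI; rewrite fx (ltW fy) !orbT.
- by move: nI; rewrite fy (ltW fx) !orbT.
Qed.

(** A sinusoid that is small at two points whose distance [h] is not a multiple
    of [pi] has small amplitude: its two coefficients are recovered from the two
    values by inverting a matrix of determinant [sin h]. *)
Lemma amplitude_le (R : realType) (A B x h : R) :
  0 <= sin h ->
  sin h * (`|A| + `|B|) <=
  2 * (`|A * sin x + B * cos x| + `|A * sin (x + h) + B * cos (x + h)|).
Proof.
move=> h0; set F := A * sin x + B * cos x.
set G := A * sin (x + h) + B * cos (x + h).
have EA : sin h * A = G * cos x - F * cos (x + h).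
  rewrite /F /G sinD cosD; have := cos2Dsin2 x.
  move: (cos x) (sin x) (cos h) (sin h) => c s c' s' cs.
  by transitivity ((c ^+ 2 + s ^+ 2) * (s' * A)); [by rewrite cs mul1r|ring].
have EB : sin h * B = F * sin (x + h) - G * sin x.
  rewrite /F /G sinD cosD; have := cos2Dsin2 x.
  move: (cos x) (sin x) (cos h) (sin h) => c s c' s' cs.
  by transitivity ((c ^+ 2 + s ^+ 2) * (s' * B)); [by rewrite cs mul1r|ring].
have le1 u v : `|u * cos v| <= `|u|.
  by rewrite normrM ler_piMr// ler_norml cos_geN1 cos_le1.
have le2 u v : `|u * sin v| <= `|u|.
  by rewrite normrM ler_piMr// ler_norml sin_geN1 sin_le1.
have hA : `|sin h * A| <= `|G| + `|F|.
  by rewrite EA; apply: le_trans (ler_normB _ _) _; apply: lerD; exact: le1.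
have hB : `|sin h * B| <= `|F| + `|G|.
  by rewrite EB; apply: le_trans (ler_normB _ _) _; apply: lerD; exact: le2.
by move: hA hB; rewrite !normrM !(ger0_norm h0); lra.
Qed.

Lemma phase_comb_dist (R : realType) (A B A' B' x : R) :
  `|(A' * sin x + B' * cos x) - (A * sin x + B * cos x)| <=
  `|A' - A| + `|B' - B|.
Proof.
rewrite (_ : _ - _ = (A' - A) * sin x + (B' - B) * cos x); last by ring.
exact: phase_comb_le.
Qed.

Lemma same_sign_le (R : realType) (x y : R) : 0 < x * y -> `|x| <= `|x + y|.
Proof.
move=> xy; have [x0|x0] := leP 0 x.
  have x1 : 0 < x.
    rewrite lt_neqAle x0 andbT.
    by apply: contraTneq xy => <-; rewrite mul0r ltxx.
  have y1 : 0 < y by rewrite -(pmulr_rgt0 _ x1).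
  by rewrite !gtr0_norm ?addr_gt0//; lra.
have y1 : y < 0 by rewrite -(nmulr_rgt0 _ x0).
have xy0 : x + y < 0 by lra.
by rewrite !ltr0_norm//; lra.
Qed.

(** Without a zero, the function keeps its sign, although its values at the
    phases [0] and [pi] from [t] nearly cancel, and so do those at the phases [h]
    and [pi + h]. Hence the sinusoid is small at the phases [0] and [h], and then
    so is its amplitude by [amplitude_le], which contradicts the relative form of
    [jost_slow_variation]. *)
Lemma zero_in_gap (R : realType) (a b : nat -> R) (d h : R) :
  jacobi_parameters a b ->
  (\sum_(1 <= n <oo) (`|a n - 1| + `|b n|)%:E < +oo)%E ->
  0 < d -> d <= pi / 2 -> 0 < h -> h <= 1 ->
  exists M, forall n t, (M <= n)%N -> d <= t ->
    t + (pi + h) / n.+2%:R <= pi - d ->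
    exists2 z, z \in `[t, t + (pi + h) / n.+2%:R] & polycos a b n.+1 z = 0.
Proof.
move=> hJ hsum d0 dpi h0 h1.
have pi2 := @pi_ge2 R.
have sd : 0 < sin d by apply: sin_gt0_pi; lra.
have sh : 0 < sin h by apply: sin_gt0_pi; lra.
have bulk t : t \in `[d, pi - d] -> sin d <= sin t.
  by apply: sin_ge_bulk; exact: ltW.
have k0 : 0 < sin h / 16 by rewrite divr_gt0.
have L0 : 0 < pi + h by rewrite addr_gt0// pi_gt0.
have dd : d <= pi - d by lra.
have [M hM] := jost_slow_variation hJ hsum dd bulk sd k0 L0.
exists M => n t Mn dt tpi; apply: contrapT => noz.
have [w w0 wE] : exists2 w : R, 0 < w & w = n.+2%:R by exists n.+2%:R.
have len u v : u <= v -> u / w <= v / w by move=> uv; rewrite ler_pM2r// invr_gt0.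
have l0 : 0 <= h / w by rewrite divr_ge0// ltW.
have l1 : 0 <= pi / w by rewrite divr_ge0 ?ltW//; lra.
have l2 : (pi + h) / w = pi / w + h / w by rewrite mulrDl.
rewrite -wE in tpi noz.
have tI : t \in `[d, pi - d] by rewrite in_itv/=; lra.
have same x y : t <= x -> x <= y -> y <= t + (pi + h) / w ->
    0 < (sin x * polycos a b n.+1 x) * (sin y * polycos a b n.+1 y).
  move=> tx xy ytw; rewrite mulrACA mulr_gt0//.
    by rewrite mulr_gt0//; apply: lt_le_trans sd _; apply: bulk; rewrite in_itv/=; lra.
  rewrite ltNge; apply/negP => /(sign_change_zero (@continuous_polycos R a b n.+1) xy).
  move=> [z]; rewrite in_itv/= => zI pz; apply: noz; exists z => //.
  by rewrite in_itv/=; lra.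
pose J := jost_norm a b n t; have J0 : 0 < J.
  by apply: jost_norm_gt0 => //; rewrite gt_eqF// (lt_le_trans sd)// bulk.
pose F x := jostA a b n t * sin x + jostB a b n t * cos x.
have near u : 0 <= u -> u <= pi + h ->
    `|sin (t + u / w) * polycos a b n.+1 (t + u / w) - F (w * t + u)| <=
    sin h / 16 * J.
  move=> u0 uh; rewrite sin_polycosS -wE mulrDr mulrCA divff ?gt_eqF// mulr1.
  apply: le_trans (phase_comb_dist _ _ _ _ _) _; apply: hM => //.
    by rewrite in_itv/=; have := len _ _ uh; have := len _ _ u0; rewrite mul0r; lra.
  by rewrite -wE opprD addrA subrr add0r normrN ger0_norm ?len// divr_ge0// ltW.
have Fpi x : F (x + pi) = - F x by rewrite /F sinDpi cosDpi; lra.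
have f0 := near 0 (lexx 0) (ltW (addr_gt0 (@pi_gt0 R) h0)).
have f1 : `| _ | <= _ := near pi (@pi_ge0 R) ltac:(lra).
have f2 := near h (ltW h0) ltac:(lra).
have f3 := near (h + pi) ltac:(lra) ltac:(lra).
rewrite mul0r !addr0 in f0.
(* The phases [0] and [pi], then [h] and [h + pi]. *)
have s01 := @same t (t + pi / w) (lexx _) ltac:(lra) ltac:(lra).
have s23 := @same (t + h / w) (t + (h + pi) / w) ltac:(lra)
  ltac:(rewrite lerD2l len//; lra) ltac:(rewrite (addrC h) lexx//).
rewrite Fpi in f1; rewrite [w * t + (h + pi)]addrA Fpi in f3.
have := same_sign_le s01; have := same_sign_le s23.
have := amplitude_le (jostA a b n t) (jostB a b n t) (w * t) (ltW sh).
rewrite -/(F (w * t)) -/(F (w * t + h)) -/(jost_norm a b n t) -/J.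
move: (F _) (F _) f0 f1 f2 f3 => F1 F0.
set P0 := sin t * _; set P1 := sin (t + pi / w) * _.
set P2 := sin (t + h / w) * _; set P3 := sin (t + (h + pi) / w) * _.
move=> f0 f1 f2 f3 amp p2 p0.
have e01 : P0 + P1 = (P0 - F0) + (P1 - - F0) by ring.
have e23 : P2 + P3 = (P2 - F1) + (P3 - - F1) by ring.
have d0' : `|P0 + P1| <= `|P0 - F0| + `|P1 - - F0| by rewrite e01 ler_normD.
have d1' : `|P2 + P3| <= `|P2 - F1| + `|P3 - - F1| by rewrite e23 ler_normD.
have c0 : `|F0| <= `|P0| + `|P0 - F0| by rewrite -{1}[F0](subKr P0) ler_normB.
have c1 : `|F1| <= `|P2| + `|P2 - F1| by rewrite -{1}[F1](subKr P2) ler_normB.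
have mJ : 0 < sin h * J by rewrite mulr_gt0.
rewrite (mulrAC (sin h)) in f0 f1 f2 f3.
move: (sin h * J) mJ amp f0 f1 f2 f3 => m mJ amp f0 f1 f2 f3.
clear hsum; lra.
Qed.

Lemma cos_inv (R : realType) (t t' z : R) :
  t \in `[0, pi] -> t' \in `[0, pi] -> 2 * cos t' < z -> z < 2 * cos t ->
  exists2 u, t < u < t' & z = 2 * cos u.
Proof.
move=> tI t'I lz zl.
have z1 : z / 2 \in `[-1, 1].
  have := cos_le1 t; have := cos_geN1 t'; rewrite in_itv/=; lra.
have uI : acos (z / 2) \in `[0, pi].
  by move: z1; rewrite !in_itv/= => z1; rewrite acos_ge0// acos_lepi.
exists (acos (z / 2)); last by rewrite acosK//; lra.
by rewrite -ltr_cos// -[X in _ && X]ltr_cos// acosK//; lra.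
Qed.

(** With [w = n + 2] and phase increment [D = w (t' - t)], the bound
    [D <= pi + 2 h] comes from [zero_in_gap]. At a zero of [p_(n+1)] one has
    [p_n = - G] and [(A_n, B_n) = (G cos (w t), - G sin (w t))]. Slow variation
    then makes [G' cos D] close to [G] and [G' sin D] close to [0], while
    interlacing gives [G G' < 0]; this excludes [D < pi - h]. *)
Lemma zero_spacing (R : realType) (a b : nat -> R) (d h : R) :
  jacobi_parameters a b ->
  (\sum_(1 <= n <oo) (`|a n - 1| + `|b n|)%:E < +oo)%E ->
  0 < d -> d <= pi / 2 -> 0 < h -> h <= 1 ->
  exists M, forall n t t', (M <= n)%N -> d <= t -> t < t' -> t' <= pi - d ->
    polycos a b n.+1 t = 0 -> polycos a b n.+1 t' = 0 ->
    (forall z, t < z < t' -> polycos a b n.+1 z != 0) ->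
    `|n.+2%:R * (t' - t) - pi| <= 2 * h.
Proof.
move=> hJ hsum d0 dpi h0 h1.
have pi2 := @pi_ge2 R.
have sd : 0 < sin d by apply: sin_gt0_pi; lra.
have sh : 0 < sin h by apply: sin_gt0_pi; lra.
have bulk t : t \in `[d, pi - d] -> sin d <= sin t.
  by apply: sin_ge_bulk; exact: ltW.
have k0 : 0 < sin h / 16 by rewrite divr_gt0.
have L0 : 0 < pi + 2 * h by rewrite addr_gt0// ?pi_gt0// mulr_gt0.
have dd : d <= pi - d by lra.
have [M1 hM1] := jost_slow_variation hJ hsum dd bulk sd k0 L0.
have [M2 hM2] := zero_in_gap hJ hsum d0 dpi h0 h1.
exists (maxn M1 M2) => n t t'; rewrite geq_max => /andP[Mn1 Mn2].
move=> dt tt' t'd pt pt' noz.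
have {hM2} gap := hM2 n (t + h / 2 / n.+2%:R) Mn2.
have {hM1} slow := hM1 n t t' Mn1.
have sinSt := sin_polycos a b n t; have sinSt' := sin_polycos a b n t'.
have zSt := sin_polycosS a b n t; have zSt' := sin_polycosS a b n t'.
have inter : polycos a b n t * polycos a b n t' < 0.
  rewrite mulrC; apply: (orthopoly_interlace hJ).
  - by rewrite ltr_pM2l// ltr_cos ?in_itv/=; lra.
  - exact/rootP.
  - exact/rootP.
  - move=> z z1 z2; have [||u uI ->] := cos_inv _ _ z1 z2.
    + by rewrite in_itv/=; lra.
    + by rewrite in_itv/=; lra.
    + exact: noz.
have freq (u : R) : n.+1%:R * u = n.+2%:R * u - u.
  by rewrite -(natr1 n.+1) mulrDl mul1r addrK.
rewrite pt mulr0 in zSt; rewrite pt' mulr0 in zSt'.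
rewrite freq in sinSt; rewrite freq in sinSt'.
have [w w0 wE] : exists2 w : R, 0 < w & w = n.+2%:R by exists n.+2%:R.
rewrite -wE in gap slow sinSt sinSt' zSt zSt' *.
have upper : w * (t' - t) <= pi + 2 * h.
  rewrite leNgt; apply/negP => hlt.
  have lt1 : t + (pi + 2 * h) / w < t'.
    by rewrite -ltrBrDl ltr_pdivrMr// [_ * w]mulrC.
  have q1 : 0 < h / 2 / w by rewrite !divr_gt0.
  (* Room for an interval of [zero_in_gap] strictly between the two zeros. *)
  have q3 : 0 < h / 2 / w + (pi + h) / w < (pi + 2 * h) / w.
    by rewrite -mulrDl divr_gt0 ?ltr_pM2r ?invr_gt0//=; lra.
  have [||z] := gap; [lra|lra|].
  rewrite in_itv/= => zI pz.
  by have := noz z; rewrite pz eqxx => /(_ ltac:(lra)).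
rewrite ler_norml; apply/andP; split; last lra.
rewrite lerBrDr -[leRHS]addr0 addrC leNgt; apply/negP => lower0.
have {lower0} lower : w * (t' - t) < pi - h by lra.
have {slow} : `|jostA a b n t' - jostA a b n t| + `|jostB a b n t' - jostB a b n t|
    <= sin h / 16 * (`|jostA a b n t| + `|jostB a b n t|).
  apply: slow; rewrite ?in_itv/=; try lra.
  rewrite distrC gtr0_norm ?subr_gt0// ler_pdivlMr// [_ * w]mulrC.
  exact: upper.
have st0 : 0 < sin t by apply: lt_le_trans sd _; apply: bulk; rewrite in_itv/=; lra.
have st'0 : 0 < sin t' by apply: lt_le_trans sd _; apply: bulk; rewrite in_itv/=; lra.
have D0 : 0 < w * (t' - t) by rewrite mulr_gt0// subr_gt0.
have cD : cos (w * (t' - t)) = cos (w * t') * cos (w * t) + sin (w * t') * sin (w * t).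
  by rewrite mulrBr cosB.
have sD : sin (w * (t' - t)) = sin (w * t') * cos (w * t) - cos (w * t') * sin (w * t).
  by rewrite mulrBr sinB.
have cs := cos2Dsin2 (w * t); have cs' := cos2Dsin2 (w * t').
rewrite sinB cosB in sinSt; rewrite sinB cosB in sinSt'.
have cb (A B u : R) : `|A * cos u + B * sin u| <= `|A| + `|B|.
  by rewrite addrC [leRHS]addrC phase_comb_le.
have cb1 A B := cb A B (w * t); have cb2 A B := phase_comb_le A B (w * t).
have c1 : `|cos (w * t)| <= 1 by rewrite ler_norml cos_geN1 cos_le1.
have s1 : `|sin (w * t)| <= 1 by rewrite ler_norml sin_geN1 sin_le1.
clear freq bulk gap noz cb.
move: (jostA a b n t) (jostB a b n t) (jostA a b n t') (jostB a b n t')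
  sinSt sinSt' zSt zSt' => A B A' B'.
move: (w * (t' - t)) lower D0 cD sD => D lower D0.
move: (cos (w * t)) (sin (w * t)) (cos (w * t')) (sin (w * t')) cs cs' cb1 cb2 c1 s1.
move=> c s c' s' cs cs' cb1 cb2 c1 s1 cD sD pn pn' F0 F0' slow.
pose G := A * c - B * s; pose G' := A' * c' - B' * s'.
have pG : polycos a b n t = - G.
  apply: (mulfI (lt0r_neq0 st0)); rewrite pn.
  transitivity ((A * s + B * c) * cos t - sin t * G); first by rewrite /G; ring.
  by rewrite -F0; ring.
have pG' : polycos a b n t' = - G'.
  apply: (mulfI (lt0r_neq0 st'0)); rewrite pn'.
  transitivity ((A' * s' + B' * c') * cos t' - sin t' * G'); first by rewrite /G'; ring.
  by rewrite -F0'; ring.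
rewrite pG pG' mulrNN in inter.
(* The vector [(A, B)] is orthogonal to [(s, c)], hence parallel to [(c, - s)]. *)
have AE : A = G * c.
  transitivity (A * (c ^+ 2 + s ^+ 2) - s * (A * s + B * c)); last by rewrite /G; ring.
  by rewrite cs -F0; ring.
have BE : B = - G * s.
  transitivity (B * (c ^+ 2 + s ^+ 2) - c * (A * s + B * c)); last by rewrite /G; ring.
  by rewrite cs -F0; ring.
have A'E : A' = G' * c'.
  transitivity (A' * (c' ^+ 2 + s' ^+ 2) - s' * (A' * s' + B' * c')).
    by rewrite cs' -F0'; ring.
  by rewrite /G'; ring.
have B'E : B' = - G' * s'.
  transitivity (B' * (c' ^+ 2 + s' ^+ 2) - c' * (A' * s' + B' * c')).
    by rewrite cs' -F0'; ring.
  by rewrite /G'; ring.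
have hcos : `|G' * cos D - G| <= `|A' - A| + `|B' - B|.
  rewrite (_ : _ - _ = (A' - A) * c + (- (B' - B)) * s).
    by rewrite -[`|B' - B|]normrN cb1.
  by rewrite {1}A'E {1}B'E cD /G; ring.
have hsin : `|G' * sin D| <= `|A' - A| + `|B' - B|.
  have -> : G' * sin D = - ((A' - A) * s + (B' - B) * c).
    transitivity (- (A' * s + B' * c - (A * s + B * c))); last by ring.
    by rewrite -F0 {1}A'E {1}B'E sD; ring.
  by rewrite normrN cb2.
have AG : `|A| <= `|G| by rewrite AE normrM ler_piMr.
have BG : `|B| <= `|G| by rewrite BE normrM normrN ler_piMr.
have sh1 : sin h <= 1 by exact: sin_le1.
have G0 : 0 < `|G|.
  by rewrite normr_gt0; apply: contraTneq inter => ->; rewrite mul0r ltxx.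
have close : `|A' - A| + `|B' - B| <= sin h / 8 * `|G|.
  apply: le_trans slow _.
  rewrite (_ : sin h / 8 * `|G| = sin h / 16 * (`|G| + `|G|)); last by lra.
  by rewrite ler_wpM2l ?lerD// ltW.
have hG : sin h * `|G| <= 1 * `|G| by rewrite ler_wpM2r// ltW.
(* For [D <= pi / 2], [G' cos D] and [G] have opposite signs; for larger [D],
   [sin D >= sin h] makes [G'] too small for [G' cos D] to be close to [G]. *)
have [Dle|Dgt] := leP D (pi / 2).
  have cD0 : 0 <= cos D by apply: cos_ge0_pihalf; lra.
  have : `|G| <= `|G' * cos D - G|.
    rewrite -(ler_pM2r G0); rewrite -!normrM -expr2 ger0_norm ?sqr_ge0//.
    apply: le_trans (_ : - ((G' * cos D - G) * G) <= _); last first.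
      by rewrite -normrN ler_norm.
    rewrite mulrBl -expr2 opprB lerBrDr gerDl mulrAC [G' * G]mulrC.
    by rewrite mulr_le0_ge0// ltW.
  clear hsum; lra.
have sD0 : sin h <= sin D.
  by apply: sin_ge_bulk; [exact: ltW|rewrite in_itv/=; lra].
have sGD : sin h * `|G'| <= `|G' * sin D|.
  rewrite normrM mulrC; apply: ler_wpM2l => //.
  exact: le_trans sD0 (ler_norm _).
have G'G : `|G'| <= `|G| / 8.
  rewrite -(ler_pM2l sh); apply: le_trans sGD _; apply: le_trans hsin _.
  by apply: le_trans close _; rewrite mulrAC -mulrA.
have cG : `|G' * cos D| <= `|G'|.
  by rewrite normrM ler_piMr// ler_norml cos_geN1 cos_le1.
have tri : `|G| <= `|G' * cos D| + `|G' * cos D - G|.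
  by have := ler_normB (G' * cos D) (G' * cos D - G); rewrite subKr.
clear hsum; lra.
Qed.

(** * The arcsine law *)

(** The square root of a negative number and the inverse of [0] are [0], so
    this vanishes outside the open interval from [-2] to [2]. *)
Definition arcsine_pdf {R : realType} (x : R) : R :=
  (pi * Num.sqrt (4 - x ^+ 2))^-1.

Lemma arcsine_pdf_ge0 (R : realType) (x : R) : 0 <= arcsine_pdf x.
Proof. by rewrite invr_ge0 mulr_ge0// pi_ge0. Qed.

Lemma arcsine_pdf_out (R : realType) (x : R) :
  x \notin `]-2, 2[ -> arcsine_pdf x = 0.
Proof.
rewrite in_itv/= -ltr_norml => h; rewrite /arcsine_pdf ler0_sqrtr ?mulr0 ?invr0//.
rewrite -leNgt in h; rewrite subr_le0 -[x ^+ 2]real_normK ?num_real//.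
have : 2 * 2 <= `|x| * `|x| by apply: ler_pM.
by rewrite expr2; lra.
Qed.

Lemma continuous_sqrt_arcsine (R : realType) :
  continuous (fun x : R => pi * Num.sqrt (4 - x ^+ 2)).
Proof.
move=> x; apply: cvgM; first exact: cvg_cst.
apply: (@continuous_comp _ _ _ (fun x : R => 4 - x ^+ 2) Num.sqrt).
  by apply: cvgB; [exact: cvg_cst|exact: exprn_continuous].
exact: sqrt_continuous.
Qed.

Lemma measurable_arcsine_pdf (R : realType) :
  measurable_fun [set: measurableTypeR R] (@arcsine_pdf R).
Proof.
rewrite (_ : arcsine_pdf = fun x => (pi * Num.sqrt (4 - x ^+ 2)) `^ (-1)).
  apply: (measurableT_comp (f := (@powR R)^~ (-1))) => //.
  apply: continuous_measurable_fun; exact: continuous_sqrt_arcsine.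
by apply/funext => x; rewrite powR_inv1// mulr_ge0// pi_ge0.
Qed.

Lemma arcsine_sqrt_gt0 (R : realType) (x : R) :
  -2 < x < 2 -> 0 < pi * Num.sqrt (4 - x ^+ 2).
Proof.
move=> h; rewrite mulr_gt0 ?pi_gt0// sqrtr_gt0.
by rewrite (_ : _ - _ = (2 - x) * (2 + x)); [rewrite mulr_gt0; lra|ring].
Qed.

Lemma continuous_arcsine_pdf (R : realType) (x : R) :
  -2 < x < 2 -> {for x, continuous (@arcsine_pdf R)}.
Proof.
move=> h; apply: cvgV; first by rewrite gt_eqF// arcsine_sqrt_gt0.
exact: continuous_sqrt_arcsine.
Qed.

Lemma is_derive_arcsine_cdf (R : realType) (x : R) :
  -2 < x < 2 ->
  is_derive x 1 (fun y : R => - pi^-1 * acos (2^-1 * y)) (arcsine_pdf x).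
Proof.
move=> h; have hx : -1 < 2^-1 * x < 1 by lra.
have d1 : is_derive x 1 (fun y : R => 2^-1 * y) 2^-1.
  have := @is_deriveZ R R R id 2^-1 x 1 1 (is_derive_id _ _).
  by move=> d; apply: (is_derive_eq d); rewrite /GRing.scale/= mulr1.
have d2 := is_derive1_acos hx.
have d3 := @is_derive1_comp _ acos (fun y : R => 2^-1 * y) x _ _ d2 d1.
have d4 := @is_deriveZ R R R (fun y : R => acos (2^-1 * y)) (- pi^-1) x _ _ d3.
apply: (is_derive_eq d4).
rewrite /arcsine_pdf /GRing.scale/=.
rewrite (_ : 4 - x ^+ 2 = 2 ^+ 2 * (1 - (2^-1 * x) ^+ 2)); last by field.
rewrite sqrtrM ?sqr_ge0// sqrtr_sqr ger0_norm// !invfM; ring.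
Qed.

Lemma arcsine_integral (R : realType) (t t' : R) :
  0 < t -> t < t' -> t' < pi ->
  (\int[@lebesgue_measure R]_(x in `[(2 * cos t')%R, (2 * cos t)%R]) (arcsine_pdf x)%:E =
   ((t' - t) / pi)%:E)%E.
Proof.
move=> t0 tt' t'pi.
have tI : t \in `[0, pi] by rewrite in_itv/=; lra.
have t'I : t' \in `[0, pi] by rewrite in_itv/=; lra.
have lt : 2 * cos t' < 2 * cos t by rewrite ltr_pM2l// ltr_cos.
have cl : -2 < 2 * cos t'.
  have : cos (pi : R) < cos t' by rewrite ltr_cos// in_itv/= pi_ge0 lexx.
  by rewrite cospi; lra.
have cr : 2 * cos t < 2.
  have : cos t < cos (0 : R) by rewrite ltr_cos// in_itv/= pi_ge0 lexx.
  by rewrite cos0; lra.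
pose F : R -> R := fun y : R => - pi^-1 * acos (2^-1 * y).
have dF (x : R) : -2 < x < 2 -> is_derive x 1 F (arcsine_pdf x).
  exact: is_derive_arcsine_cdf.
have cF (x : R) : -2 < x < 2 -> {for x, continuous F}.
  move=> /dF h; apply: differentiable_continuous.
  exact/derivable1_diffP/ex_derive.
rewrite (@continuous_FTC2 _ _ F)//.
- rewrite -EFinB; congr EFin; rewrite /F !mulrA mulVf// !mul1r !cosK//; ring.
- apply/continuous_in_subspaceT => x; rewrite inE/= in_itv/= => xI.
  by apply: continuous_arcsine_pdf; lra.
- split.
  + move=> x; rewrite in_itv/= => xI; apply: ex_derive; apply: dF; lra.
  + by apply: cvg_at_right_filter; apply: cF; lra.
  + by apply: cvg_at_left_filter; apply: cF; lra.
- move=> x; rewrite in_itv/= => xI; rewrite derive1E; apply: derive_val.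
  by apply: dF; lra.
Qed.

Section arcsine_law.
Context {R : realType}.
Local Open Scope ereal_scope.

(** The image of the normalized Lebesgue measure of [[0, pi]] under [2 cos t],
    given by its density. *)
Definition arcsine_law (A : set (measurableTypeR R)) : \bar R :=
  \int[@lebesgue_measure R]_(x in A) (arcsine_pdf x)%:E.

Let arcsine_law0 : arcsine_law set0 = 0.
Proof. exact: integral_set0. Qed.

Let arcsine_law_ge0 A : 0 <= arcsine_law A.
Proof. by apply: integral_ge0 => x _; rewrite lee_fin arcsine_pdf_ge0. Qed.

Let arcsine_law_sigma_additive : semi_sigma_additive arcsine_law.
Proof.
move=> /= F mF tF mUF; apply: cvg_toP.
  apply: ereal_nondecreasing_is_cvgn => m n mn.
  by apply: lee_sum_nneg_natr => // k _ _; exact: arcsine_law_ge0.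
rewrite /arcsine_law ge0_integral_bigcup//=.
- by apply: measurable_funTS; apply/measurable_EFinP; exact: measurable_arcsine_pdf.
- by move=> x _; rewrite lee_fin arcsine_pdf_ge0.
Qed.

HB.instance Definition _ := isMeasure.Build _ _ _ arcsine_law
  arcsine_law0 arcsine_law_ge0 arcsine_law_sigma_additive.

Lemma arcsine_law_itvcc (t t' : R) :
  (0 < t -> t < t' -> t' < pi ->
  arcsine_law `[2 * cos t', 2 * cos t]%classic = ((t' - t) / pi)%:E)%R.
Proof. exact: arcsine_integral. Qed.

Lemma arcsine_law_itvco (t t' : R) :
  (0 < t -> t < t' -> t' < pi ->
  arcsine_law `[2 * cos t', 2 * cos t[%classic = ((t' - t) / pi)%:E)%R.
Proof.
move=> t0 tt' t'pi; rewrite -arcsine_law_itvcc// /arcsine_law.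
rewrite integral_itv_bndo_bndc//; apply: measurable_funTS.
by apply/measurable_EFinP; exact: measurable_arcsine_pdf.
Qed.

Let arcsine_lawT : arcsine_law [set: _] = 1.
Proof.
(* The fundamental theorem of calculus applies on the closed subintervals
     of the open support, which they exhaust. *)
pose t (k : nat) : R := (k.+2%:R)^-1%R.
have t0 k : (0 < t k)%R by rewrite invr_gt0 ltr0n.
have t1 k : (t k <= 2^-1)%R by rewrite lef_pV2 ?posrE ?ltr0n// ler_nat.
have tpi k : (t k < pi - t k)%R by have := t1 k; have := @pi_ge2 R; lra.
pose F k := `[2 * cos (pi - t k), 2 * cos (t k)]%classic%R : set (measurableTypeR R).
have mF k : arcsine_law (F k) = (1 - 2 * t k / pi)%:E.
  rewrite arcsine_law_itvcc ?tpi//; last by rewrite gtrDl oppr_lt0.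
  congr EFin; move: (@pi_gt0 R); move: (pi : R) => p p0; field.
  by rewrite gt_eqF.
have cvgt : t @ \oo --> (0 : R)%R.
  by rewrite (cvg_shiftS (harmonic : nat -> R)); exact: cvg_harmonic.
have ndF : nondecreasing_seq F.
  move=> m n mn; apply/subsetPset => x.
  have tnm : (t n <= t m)%R by rewrite lef_pV2 ?posrE ?ltr0n// ler_nat !ltnS.
  have c : (cos (t m) <= cos (t n))%R.
    have tI j : t j \in `[0%R, pi] by rewrite in_itv/=; have := tpi j; have := t0 j; lra.
    by rewrite leNgt (ltr_cos (tI m) (tI n)) -leNgt.
  rewrite /F /= !in_itv/= !(addrC pi) !cosDpi !cosN => /andP[h1 h2].
  by apply/andP; split; lra.
have FE : \bigcup_k F k = `]-2, 2[%classic%R.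
  apply/seteqP; split => x.
    move=> [k _]; rewrite /F /= !in_itv/= !(addrC pi) !cosDpi !cosN => h.
    have : (cos (t k) < cos 0)%R.
      by rewrite ltr_cos ?in_itv/= ?lexx ?pi_ge0//; have := tpi k; have := t0 k; lra.
    by rewrite cos0; lra.
  rewrite /= in_itv/= => h.
  have /cvgrPdist_lt /(_ (2 - `|x|)%R) :
      (2 * cos (t k))%R @[k --> \oo] --> (2 * cos 0 : R)%R.
    apply: cvgM; first exact: cvg_cst.
    by apply: (cvg_comp _ _ cvgt); exact: continuous_cos.
  rewrite subr_gt0 ltr_norml => /(_ h)[N _ /(_ N (leqnn N))]/=.
  rewrite cos0 mulr1 => hN; exists N => //.
  rewrite /F /= !in_itv/= !(addrC pi) !cosDpi !cosN.
  have := le_lt_trans (ler_norm _) hN => h1.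
  have := ler_norm x; have := ler_norm (- x)%R; rewrite normrN.
  by move=> h2 h3; apply/andP; split; lra.
have mu_oo : arcsine_law (`]-2, 2[%classic)%R = 1.
  rewrite -FE.
  have mFk k : measurable (F k) by exact: measurable_itv.
  have mFU : measurable (\bigcup_k F k) by exact: bigcupT_measurable.
  have h := nondecreasing_cvg_mu (mu := arcsine_law) mFk mFU ndF.
  apply: (@cvg_unique _ (@ereal_hausdorff R) _ _ _ _ h).
  rewrite (_ : _ \o _ = fun k => (1 - 2 * t k / pi)%:E); last exact/funext.
  apply: cvg_EFin; first by near=> k.
  rewrite -[X in _ --> X]subr0; apply: cvgB; first exact: cvg_cst.
  rewrite -[X in _ --> X](mul0r (pi^-1)%R); apply: cvgM; last exact: cvg_cst.
  by rewrite -[X in _ --> X](mulr0 2%R); apply: cvgM; first exact: cvg_cst.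
rewrite -(setvU `]-2, 2[%classic%R) measureU//; last 2 first.
- by apply: measurableC; exact: measurable_itv.
- by rewrite setICl.
rewrite [X in _ + X = _]mu_oo [X in X + _]integral0_eq ?add0e// => x /= /negP.
by move=> /arcsine_pdf_out ->.
Unshelve. all: by end_near. Qed.

HB.instance Definition _ := @Measure_isProbability.Build _ _ R
  arcsine_law arcsine_lawT.

End arcsine_law.

(** * Averages over the zeros *)

(** The integral of [f] against the zero counting measure. *)
Definition zero_average (R : realType) (a b : nat -> R) (f : R -> R) (n : nat)
    : R :=
  n%:R^-1 * \sum_(x <- rootsR (orthopoly a b n)) f x.

(** The zero counting measure thus has total mass at most [1]. *)
Lemma size_zeros (R : realType) (a b : nat -> R) (n : nat) :
  jacobi_parameters a b -> (size (rootsR (orthopoly a b n)) <= n)%N.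
Proof.
move=> hJ; have p0 := orthopoly_neq0 n hJ.
have := max_poly_roots p0 (rs := rootsR (orthopoly a b n)).
rewrite uniq_roots => h; rewrite -ltnS; apply: leq_trans (size_orthopoly a b n).
apply: h => //; apply/allP => x.
by rewrite -roots_on_rootsR// => /andP[].
Qed.

Lemma integral_zero_measure_ge0 (R : realType) (a b : nat -> R) (f : R -> R)
    (n : nat) :
  measurable_fun [set: measurableTypeR R] f -> (forall x, 0 <= f x) ->
  (\int[zero_measure a b n]_x (f x)%:E = (zero_average a b f n)%:E)%E.
Proof.
move=> mf f0; have mEf := (measurable_EFinP _ _).2 mf.
rewrite ge0_integral_mscale//=; last by move=> x _; rewrite lee_fin.
rewrite ge0_integral_measure_sum//; last by move=> x _; rewrite lee_fin.
rewrite EFinM; congr (_ * _)%E.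
rewrite (big_nth 0) big_mkord -sumEFin; apply: eq_bigr => i _.
by rewrite integral_dirac// diracT mul1e.
Qed.

Lemma integral_zero_measure (R : realType) (a b : nat -> R) (f : R -> R)
    (n : nat) :
  measurable_fun [set: measurableTypeR R] f ->
  (\int[zero_measure a b n]_x (f x)%:E = (zero_average a b f n)%:E)%E.
Proof.
move=> mf; rewrite integralE.
have -> : ((fun x => (f x)%:E) ^\+ = fun x => (Num.max (f x) 0)%:E)%E.
  by apply/funext => x; rewrite funeposE EFin_max.
have -> : ((fun x => (f x)%:E) ^\- = fun x => (Num.max (- f x) 0)%:E)%E.
  by apply/funext => x; rewrite funenegE EFin_max.
rewrite !integral_zero_measure_ge0.
- rewrite -EFinB; congr EFin; rewrite /zero_average -mulrBr; congr (_ * _).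
  rewrite -sumrB; apply: eq_bigr => x _.
  by have [|] := leP (f x) 0; have [|] := leP (- f x) 0; lra.
- by apply: measurable_maxr => //; exact: measurableT_comp.
- by move=> x; rewrite le_max lexx orbT.
- by apply: measurable_maxr => //; exact: measurable_cst.
- by move=> x; rewrite le_max lexx orbT.
Qed.

(** An upper Riemann sum in the angle variable, where the arcsine law has
    constant density [1 / pi]. The image under [2 cos t] of the half-open cell
    [(t_k, t_(k+1)]] is closed on the left and open on the right, because the
    cosine is decreasing. *)
Lemma arcsine_integral_itv_le (R : realType) (f : R -> R) (c : nat -> R)
    (s l : R) (K : nat) :
  measurable_fun [set: measurableTypeR R] f -> (forall x, 0 <= f x) ->
  0 < s -> 0 < l -> s + K%:R * l < pi ->
  (forall k t, (k < K)%N -> s + k%:R * l < t <= s + k.+1%:R * l ->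
     f (2 * cos t) <= c k) ->
  (\int[arcsine_law]_(x in `[(2 * cos (s + K%:R * l))%R, (2 * cos s)%R[) (f x)%:E
   <= (\sum_(k < K) c k * (l / pi))%:E)%E.
Proof.
move=> mf f0 s0 l0; have mEf := (measurable_EFinP _ _).2 mf.
elim: K => [|K IH] sK fc.
  by rewrite mul0r addr0 set_itvco0 integral_set0 big_ord0.
have lS : s + K.+1%:R * l = s + K%:R * l + l by rewrite -natr1 mulrDl mul1r addrA.
rewrite lS in sK *.
have K0 : 0 <= K%:R * l by rewrite mulr_ge0 ?ler0n// ltW.
have I1 : s + K%:R * l + l \in `[0, pi] by rewrite in_itv/=; lra.
have I2 : s + K%:R * l \in `[0, pi] by rewrite in_itv/=; lra.
have I3 : s \in `[0, pi] by rewrite in_itv/=; lra.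
have cos12 : cos (s + K%:R * l + l) < cos (s + K%:R * l) by rewrite ltr_cos//; lra.
have cos23 : cos (s + K%:R * l) <= cos s by rewrite leNgt ltr_cos// -leNgt; lra.
rewrite (@itv_bndbnd_setU _ _ _ (BLeft (2 * cos (s + K%:R * l)))); last 2 first.
- by rewrite bnd_simp; lra.
- by rewrite bnd_simp; lra.
rewrite ge0_integral_setU//=; last 3 first.
- by apply: measurable_funTS.
- by move=> x _; rewrite lee_fin.
- apply/disj_setPS => x [/=]; rewrite !in_itv/= => /andP[_ h] /andP[h' _].
  by move: (lt_le_trans h h'); rewrite ltxx.
rewrite big_ord_recr/= addrC EFinD; apply: leeD; last first.
  by apply: IH; [lra|move=> k t kK; apply: fc; exact: ltnW].
apply: (@le_trans _ _ (\int[arcsine_law]_(x in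
    `[(2 * cos (s + K%:R * l + l))%R, (2 * cos (s + K%:R * l))%R[) (c K)%:E)%E).
  apply: ge0_le_integral => //=.
  - by move=> x _; rewrite lee_fin.
  - exact: measurable_funTS.
  - move=> x; rewrite in_itv/= lee_fin => /andP[x1 x2].
    have x1' : -1 <= x / 2 <= 1.
      have := cos_geN1 (s + K%:R * l + l); have := cos_le1 (s + K%:R * l).
      by move=> *; apply/andP; split; lra.
    have -> : x = 2 * cos (acos (x / 2)) by rewrite acosK ?in_itv//; lra.
    apply: fc => //; rewrite lS.
    have tI : acos (x / 2) \in `[0, pi] by rewrite in_itv/= acos_ge0// acos_lepi.
    have ca : cos (acos (x / 2)) = x / 2 by rewrite acosK ?in_itv.
    apply/andP; split; first by rewrite -(ltr_cos I2 tI) ca; lra.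
    by rewrite leNgt -(ltr_cos I1 tI) ca -leNgt; lra.
rewrite integral_cst//= arcsine_law_itvco -?EFinM ?lee_fin; try lra.
Qed.

Lemma arcsine_integral_le (R : realType) (f : R -> R) (c : nat -> R)
    (M s l : R) (K : nat) :
  measurable_fun [set: measurableTypeR R] f -> (forall x, 0 <= f x <= M) ->
  0 < s -> 0 < l -> s + K%:R * l < pi ->
  (forall k t, (k < K)%N -> s + k%:R * l < t <= s + k.+1%:R * l ->
     f (2 * cos t) <= c k) ->
  (\int[arcsine_law]_x (f x)%:E <=
   (\sum_(k < K) c k * (l / pi) + M * (1 - K%:R * l / pi))%:E)%E.
Proof.
move=> mf fM s0 l0 sK fc; have mEf := (measurable_EFinP _ _).2 mf.
have f0 x : 0 <= f x by have /andP[] := fM x.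
set U := `[2 * cos (s + K%:R * l), 2 * cos s[%classic : set (measurableTypeR R).
have mU : measurable U by exact: measurable_itv.
have -> : (\int[arcsine_law]_x (f x)%:E =
    \int[arcsine_law]_(x in U) (f x)%:E + \int[arcsine_law]_(x in ~` U) (f x)%:E)%E.
  rewrite -ge0_integral_setU ?setvU ?setUv//.
  - exact: measurableC.
  - by move=> x _; rewrite lee_fin.
  - by apply/disj_setPS; rewrite setICr.
rewrite EFinD; apply: leeD; first exact: arcsine_integral_itv_le.
have UE : arcsine_law U = (K%:R * l / pi)%:E.
  case: (K) @U sK {fc mU} => [|K'] /= sK.
    by rewrite !mul0r addr0 set_itvco0 measure0.
  have K0 : 0 < K'.+1%:R * l by rewrite mulr_gt0// ltr0n.
  by rewrite arcsine_law_itvco//; [congr EFin; lra|lra].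
apply: (@le_trans _ _ (\int[arcsine_law]_(x in ~` U) M%:E)%E).
  apply: ge0_le_integral => //=.
  - exact: measurableC.
  - by move=> x _; rewrite lee_fin.
  - exact: measurable_funTS.
  - by move=> x _; rewrite lee_fin; have /andP[] := fM x.
rewrite integral_cst//=; last exact: measurableC.
have -> : arcsine_law (~` U) = (1 - K%:R * l / pi)%:E.
  by have := probability_setC arcsine_law mU; rewrite /= UE.
by rewrite -EFinM.
Qed.

Lemma ler_sum_subseq (R : realType) (f : R -> R) (s1 s2 : seq R) :
  uniq s1 -> uniq s2 -> {subset s1 <= s2} -> (forall x, 0 <= f x) ->
  \sum_(x <- s1) f x <= \sum_(x <- s2) f x.
Proof.
move=> u1 u2 s12 f0; have e : perm_eq [seq x <- s2 | x \in s1] s1.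
  apply: uniq_perm => //; first exact: filter_uniq.
  move=> x; rewrite mem_filter; apply/andP/idP => [[]//|xs1].
  by split => //; exact: s12.
rewrite [leRHS](bigID (fun x => x \in s1)) -big_filter (perm_big _ e).
by rewrite lerDl sumr_ge0.
Qed.

(** Cut the angles into cells of length [l = (pi + 2 h) / (n + 2)]. By
    [zero_in_gap] each cell contains a zero of [p_(n+1)], and the slack [h] makes
    these zeros distinct. By uniform continuity the upper Riemann sum of
    [arcsine_integral_le] over the cells is close to the sum of [f] over these
    zeros, weighted by [l / pi], which is close to [1 / (n + 1)]. *)
Lemma zero_average_liminf (R : realType) (a b : nat -> R) (f : R -> R)
    (M k : R) :
  jacobi_parameters a b ->
  (\sum_(1 <= n <oo) (`|a n - 1| + `|b n|)%:E < +oo)%E ->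
  continuous f -> (forall x, 0 <= f x <= M) -> 0 < M -> 0 < k ->
  exists N, forall n, (N <= n)%N ->
    (\int[arcsine_law]_x (f x)%:E <= (zero_average a b f n.+1 + k)%:E)%E.
Proof.
move=> hJ hsum cf fM M0 k0.
have mf : measurable_fun [set: measurableTypeR R] f.
  exact: continuous_measurable_fun.
have f0 x : 0 <= f x by have /andP[] := fM x.
have pi2 := @pi_ge2 R.
pose h := Num.min 1 (k / (4 * M)).
have h0 : 0 < h by rewrite lt_min ltr01 divr_gt0 ?mulr_gt0.
have h1 : h <= 1 by rewrite ge_min lexx.
have hk : M * h <= k / 4.
  have : h <= k / (4 * M) by rewrite ge_min lexx orbT.
  by rewrite ler_pdivlMr ?mulr_gt0//; lra.
have hpi : h <= pi / 2 by lra.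
have [N1 gap] := zero_in_gap hJ hsum h0 hpi h0 h1.
pose g t := f (2 * cos t).
have cg : continuous g.
  move=> t; apply: (@continuous_comp _ _ _ (fun t => 2 * cos t) f).
    by apply: cvgM; [exact: cvg_cst|exact: continuous_cos].
  exact: cf.
have k4 : 0 < k / 4 by rewrite divr_gt0.
have [r r0 unif] := @segment_uniformly_continuous R g 0 pi _ cg k4.
pose m := Num.min r (k / (4 * M)).
have m0 : 0 < m by rewrite lt_min r0 divr_gt0 ?mulr_gt0.
exists (maxn N1 (Num.truncn ((pi + 2) / m))) => n; rewrite geq_max => /andP[Nn1 Nn2].
have [w w0 wE] : exists2 w : R, 0 < w & w = n.+2%:R by exists n.+2%:R.
pose l := (pi + 2 * h) / w.
have l0 : 0 < l by rewrite divr_gt0//; lra.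
have lm : l < m.
  rewrite ltr_pdivrMr// [m * w]mulrC -ltr_pdivrMr//.
  apply: (@le_lt_trans _ _ ((pi + 2) / m)).
    by rewrite ler_pM2r ?invr_gt0//; lra.
  apply: lt_le_trans (truncnS_gt _) _.
  by rewrite wE ler_nat ltnS (leq_trans Nn2).
have lr : l < r by apply: lt_le_trans lm _; rewrite ge_min lexx.
have lM : M * l <= k / 4.
  have : l < k / (4 * M) by apply: lt_le_trans lm _; rewrite ge_min lexx orbT.
  by rewrite ltr_pdivlMr ?mulr_gt0//; lra.
pose K := Num.truncn ((pi - 2 * h) / l).
have /andP[K1 K2] : K%:R <= (pi - 2 * h) / l < K.+1%:R.
  by apply: truncn_itv; apply: divr_ge0; [lra|exact: ltW].
rewrite ler_pdivlMr// in K1; rewrite ltr_pdivrMr// -[K.+1%:R]natr1 mulrDl mul1r in K2.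
have tK j : (j < K)%N -> h + j.+1%:R * l <= pi - h.
  move=> jK; have : j.+1%:R * l <= K%:R * l by rewrite ler_pM2r// ler_nat.
  by lra.
have tS j : h + j.+1%:R * l = h + j%:R * l + l by rewrite -natr1 mulrDl mul1r addrA.
have t0 j : 0 <= j%:R * l by rewrite mulr_ge0 ?ler0n// ltW.
have lw : (pi + h) / w < l by rewrite /l ltr_pM2r ?invr_gt0//; lra.
have /choice[z zP] : forall j, exists z, (j < K)%N ->
    h + j%:R * l <= z < h + j.+1%:R * l /\ polycos a b n.+1 z = 0.
  move=> j; have [jK|_] := ltnP j K; last by exists 0.
  have [||z] := gap n (h + j%:R * l) Nn1.
  - by have := t0 j; lra.
  - by rewrite -wE; have := tK j jK; rewrite tS; lra.
  rewrite -wE in_itv/= => /andP[z1 z2] pz; exists z => _; split=> //.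
  by rewrite z1 tS; lra.
have zI j : (j < K)%N -> z j \in `[0, pi].
  move=> jK; have [/andP[z1 z2] _] := zP j jK.
  by have := tK j jK; have := t0 j; rewrite in_itv/=; lra.
have zlt i j : (i < j)%N -> (j < K)%N -> z i < z j.
  move=> ij jK; have [/andP[_ z2] _] := zP i (ltn_trans ij jK).
  have [/andP[z3 _] _] := zP j jK; apply: lt_le_trans z2 _; apply: le_trans z3.
  by rewrite lerD2l ler_pM2r// ler_nat.
pose zs := [seq 2 * cos (z j) | j <- iota 0 K].
have uzs : uniq zs.
  rewrite map_inj_in_uniq ?iota_uniq// => i j; rewrite !mem_iota/= add0n => iK jK.
  move=> /(mulfI _)e; have {e} : cos (z i) = cos (z j) by apply: e; rewrite pnatr_eq0.
  move=> /(cos_inj (zI i iK) (zI j jK)) zij.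
  have [ij|ji|//] := ltngtP i j.
  - by have := zlt _ _ ij jK; rewrite zij ltxx.
  - by have := zlt _ _ ji iK; rewrite zij ltxx.
set p := orthopoly a b n.+1.
have p0 : p != 0 by exact: orthopoly_neq0.
have zsub : {subset zs <= rootsR p}.
  move=> x /mapP[j]; rewrite mem_iota/= add0n => jK ->.
  by rewrite -roots_on_rootsR// in_itv/=; apply/rootP; have [] := zP j jK.
have S1 := ler_sum_subseq uzs (uniq_roots _ _ _) zsub f0.
rewrite big_map -{1}(subn0 K) -/(index_iota 0 K) big_mkord in S1.
set S := \sum_(x <- rootsR p) f x in S1.
have avgE : S = n.+1%:R * zero_average a b f n.+1.
  by rewrite /zero_average mulrA divff ?mul1r// pnatr_eq0.
have SM : S <= n.+1%:R * M.
  apply: (@le_trans _ _ (\sum_(x <- rootsR p) M)).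
    by apply: ler_sum => x _; have /andP[] := fM x.
  rewrite big_const_seq count_predT iter_addr_0 -[leLHS]mulr_natl.
  by apply: ler_wpM2r; [exact: ltW|rewrite ler_nat size_zeros].
have S0 : 0 <= S by apply: sumr_ge0.
have sK : h + K%:R * l < pi by lra.
have fc j t : (j < K)%N -> h + j%:R * l < t <= h + j.+1%:R * l ->
    f (2 * cos t) <= f (2 * cos (z j)) + k / 4.
  move=> jK /andP[t1 t2]; have [/andP[z1 z2] _] := zP j jK.
  have tz : `|z j - t| < r by rewrite ltr_norml; rewrite tS in t2 z2; lra.
  by have := unif (z j) t (zI j jK) tz; rewrite /g ltr_norml; lra.
apply: le_trans (arcsine_integral_le mf fM h0 l0 sK fc) _.
rewrite lee_fin -big_distrl/= big_split/= sumr_const card_ord -[k / 4 *+ K]mulr_natl.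
set T := \sum_(i < K) f (2 * cos (z i)) in S1 *.
have pi0 := @pi_gt0 R.
set v := zero_average a b f n.+1 in avgE *.
have N0 : 0 < n.+1%:R :> R by rewrite ltr0n.
have v0 : 0 <= v by rewrite -(pmulr_rge0 _ N0) -avgE.
have vM : v <= M by rewrite -(ler_pM2l N0) -avgE.
have Nl : n.+1%:R * l <= pi + 2 * h.
  have lwE : w * l = pi + 2 * h by rewrite /l mulrC divfK// gt_eqF.
  by rewrite -lwE wE ler_pM2r// ler_nat.
have e1 : T * l <= pi * v + 2 * (M * h).
  apply: (@le_trans _ _ (S * l)); first by rewrite ler_pM2r.
  rewrite avgE mulrAC; apply: (@le_trans _ _ ((pi + 2 * h) * v)).
    by rewrite ler_wpM2r.
  have : h * v <= h * M by rewrite ler_pM2l.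
  by lra.
have e2 : K%:R * l * k <= pi * k by rewrite ler_pM2r//; lra.
have e3 : M * (pi - K%:R * l) <= M * (2 * h + l) by rewrite ler_pM2l//; lra.
have e4 : 2 * k <= pi * k by rewrite ler_pM2r.
rewrite -(ler_pM2r pi0).
rewrite (_ : (_ + _) * pi = T * l + K%:R * l * k / 4 + M * (pi - K%:R * l)).
  by lra.
by clear -pi0; move: (K%:R) T pi pi0 => q T p p0; field; rewrite gt_eqF.
Qed.

(** * The density of states *)

Lemma zero_average_add_le (R : realType) (a b : nat -> R) (f : R -> R) (M : R)
    (n : nat) :
  jacobi_parameters a b -> 0 <= M ->
  zero_average a b (fun x => M + f x) n.+1 <= M + zero_average a b f n.+1.
Proof.
move=> hJ M0; rewrite /zero_average big_split/= mulrDr lerD2r.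
rewrite big_const_seq count_predT iter_addr_0 -[M *+ _]mulr_natl.
rewrite ler_pdivrMl ?ltr0n//; apply: ler_wpM2r => //.
by rewrite ler_nat size_zeros.
Qed.

(** The lower bound of [zero_average_liminf], applied to the nonnegative
    functions [M + f] and [M - f], bounds the averages of [f] from both sides. *)
Lemma arcsine_density_of_states (R : realType) (a b : nat -> R) :
  jacobi_parameters a b ->
  (\sum_(1 <= n <oo) (`|a n - 1| + `|b n|)%:E < +oo)%E ->
  density_of_states a b arcsine_law.
Proof.
move=> hJ hsum f cf [M0 [_ bf]].
pose M := Num.max M0 0 + 1.
have M1 : 0 < M by rewrite ltr_wpDl// le_max lexx orbT.
have fM x : `|f x| <= M.
  by apply: bf => //; rewrite ltr_pwDr// le_max lexx.
have mf : measurable_fun [set: measurableTypeR R] f.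
  exact: continuous_measurable_fun.
have intf : arcsine_law.-integrable [set: measurableTypeR R] (EFin \o f).
  apply: measurable_bounded_integrable => //.
    by rewrite (le_lt_trans (probability_le1 _ _))// ltry.
  exists M; split; first exact: num_real.
  by move=> y My x _; exact: le_trans (fM x) (ltW My).
have intM : arcsine_law.-integrable [set: measurableTypeR R] (EFin \o cst M).
  by apply: finite_measure_integrable_cst.
have IE : (\int[arcsine_law]_x (f x)%:E = (fine (\int[arcsine_law]_x (f x)%:E))%:E)%E.
  by rewrite fineK//; exact: integrable_fin_num.
set I := fine _ in IE.
have cstM : (\int[arcsine_law]_x (cst M x)%:E = M%:E)%E.
  transitivity (M%:E * arcsine_law [set: measurableTypeR R])%E.
    exact: (integral_cst arcsine_law measurableT M%:E).
  by rewrite [X in (_ * X)%E]probability_setT mule1.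
have ID : (\int[arcsine_law]_x (M + f x)%:E = (M + I)%:E)%E.
  rewrite EFinD -IE -cstM.
  exact: (integralD_EFin measurableT intM intf).
have IB : (\int[arcsine_law]_x (M + - f x)%:E = (M - I)%:E)%E.
  rewrite EFinB -IE -cstM.
  exact: (integralB_EFin measurableT intM intf).
rewrite (_ : (fun n => _) = EFin \o zero_average a b f); last first.
  by apply/funext => n; rewrite integral_zero_measure.
rewrite IE; apply: cvg_EFin; first by near=> k.
rewrite -cvg_shiftS; apply/cvgrPdist_le => e e0.
have M2 : 0 < 2 * M by rewrite mulr_gt0.
have cD : continuous (fun x => M + f x).
  by move=> x; apply: cvgD; [exact: cvg_cst|exact: cf].
have cB : continuous (fun x => M + - f x).
  by move=> x; apply: cvgB; [exact: cvg_cst|exact: cf].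
have bD x : 0 <= M + f x <= 2 * M.
  by have := fM x; rewrite ler_norml; lra.
have bB x : 0 <= M + - f x <= 2 * M.
  by have := fM x; rewrite ler_norml; lra.
have [N1 h1] := zero_average_liminf hJ hsum cD bD M2 e0.
have [N2 h2] := zero_average_liminf hJ hsum cB bB M2 e0.
exists (maxn N1 N2) => // n; rewrite /= geq_max => /andP[n1 n2].
have := h1 n n1; rewrite ID lee_fin.
have := h2 n n2; rewrite IB lee_fin.
have := zero_average_add_le f n hJ (ltW M1).
have := zero_average_add_le (fun x => - f x) n hJ (ltW M1).
have -> : zero_average a b (fun x => - f x) n.+1 = - zero_average a b f n.+1.
  by rewrite /zero_average sumrN mulrN.
move=> *; rewrite ler_norml; lra.
Unshelve. all: by end_near. Qed.

(** * Clock behavior *)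

Lemma sin_dist_le (R : realType) (x y : R) : `|sin x - sin y| <= `|x - y|.
Proof.
wlog xy : x y / x <= y => [H|].
  by have [/H//|/ltW/H] := leP x y; rewrite distrC (distrC y).
have dsin (z : R) : is_derive z 1 (@sin R) (cos z) by exact: is_derive_sin.
have [z _ E] := @MVT_segment R sin cos x y xy (fun z _ => dsin z)
  (continuous_subspaceT (@continuous_sin R)).
rewrite distrC E normrM (distrC x) ler_piMl//.
by rewrite ler_norml cos_geN1 cos_le1.
Qed.

Lemma cos_diff_le (R : realType) (t t' s : R) :
  t <= s <= t' -> `|cos t - cos t' - (t' - t) * sin s| <= (t' - t) ^+ 2.
Proof.
move=> /andP[ts st']; have tt' : t <= t' by lra.
have dcos (z : R) : is_derive z 1 (@cos R) (- sin z) by exact: is_derive_cos.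
have [z zI E] := @MVT_segment R cos (fun z => - sin z) t t' tt' (fun z _ => dcos z)
  (continuous_subspaceT (@continuous_cos R)).
have -> : cos t - cos t' - (t' - t) * sin s = (t' - t) * (sin z - sin s) by lra.
rewrite normrM expr2 ger0_norm ?subr_ge0// ler_wpM2l ?subr_ge0//.
apply: le_trans (sin_dist_le _ _) _; rewrite ler_norml.
by move: zI; rewrite in_itv/=; lra.
Qed.

Lemma arcsine_pdf_inv (R : realType) (t : R) :
  0 <= t <= pi -> (arcsine_pdf (2 * cos t))^-1 = 2 * pi * sin t.
Proof.
move=> tI; rewrite invrK (_ : 4 - _ = (2 * sin t) ^+ 2).
  by rewrite sqrtr_sqr ger0_norm ?mulr_ge0// ?sin_ge0_pi//; lra.
by have := cos2Dsin2 t; lra.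
Qed.

(** Passage from the angle to the energy: [2 cos t - 2 cos t'] is
    [2 (t' - t) sin s] up to a quadratic error, and [t' - t] is of order [1 / w].
    The factor [w - 1] is the degree of the polynomial whose zeros have phase
    frequency [w]. *)
Lemma clock_gap (R : realType) (t t' s h w : R) :
  0 < h -> h <= 1 -> t <= s <= t' -> 1 < w -> 0 <= sin s ->
  `|w * (t' - t) - pi| <= 2 * h ->
  `|(w - 1) * (2 * cos t - 2 * cos t') - 2 * pi * sin s| <= 4 * h + 84 / w.
Proof.
move=> h0 h1 tst w1 s0 spacing.
have pi4 : pi < 4 :> R by have := @pihalf_lt2 R; lra.
have w0 : 0 < w by lra.
set D := t' - t in spacing *; have D0 : 0 <= D by rewrite /D; lra.
have hw : w * D <= 6 by move: spacing; rewrite ler_norml; lra.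
have Dw : D <= 6 / w by rewrite ler_pdivlMr// mulrC.
have := cos_diff_le tst; rewrite -/D => hc.
have s1 : sin s <= 1 by exact: sin_le1.
have DD : (w - 1) * D ^+ 2 <= 36 / w.
  have : w * D * D <= 6 * (6 / w) by apply: ler_pM => //; rewrite mulr_ge0// ltW.
  have : 0 <= D * D by exact: mulr_ge0.
  by rewrite expr2; lra.
set X := cos t - cos t' in hc *.
have -> : (w - 1) * (2 * cos t - 2 * cos t') - 2 * pi * sin s =
    2 * ((w - 1) * (X - D * sin s)) + 2 * sin s * (w * D - pi) - 2 * sin s * D.
  by rewrite /X; ring.
have e1 : `|(w - 1) * (X - D * sin s)| <= 36 / w.
  rewrite normrM ger0_norm; last lra.
  by apply: le_trans DD; rewrite ler_wpM2l//; lra.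
have e2 : `|sin s * (w * D - pi)| <= 2 * h.
  rewrite normrM ger0_norm//; apply: le_trans spacing.
  exact: ler_piMl.
have e3 : 0 <= sin s * D by exact: mulr_ge0.
have e4 : sin s * D <= D by exact: ler_piMl.
by move: e1 e2; rewrite !ler_norml; lra.
Qed.

(** The bulk angle [d] is taken from [min (eps, 1)], so that it stays in
    [(0, pi / 2]] even when the interval of energies is a point or empty. *)
Lemma clock_spacing (R : realType) (a b : nat -> R) (eps k : R) :
  jacobi_parameters a b ->
  (\sum_(1 <= n <oo) (`|a n - 1| + `|b n|)%:E < +oo)%E ->
  0 < eps -> 0 < k ->
  exists N, forall n E E', (N <= n)%N ->
    successive_zeros_in (orthopoly a b n) (- 2 + eps) (2 - eps) E E' ->
    `|n%:R * `|E - E'| - (arcsine_pdf E)^-1| <= k.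
Proof.
move=> hJ hsum eps0 k0.
pose e := Num.min eps 1.
have e0 : 0 < e by rewrite lt_min eps0 ltr01.
have e1 : e <= 1 by rewrite ge_min lexx orbT.
have ee : e <= eps by rewrite ge_min lexx.
pose d := acos (1 - e / 2).
have dI : -1 <= 1 - e / 2 <= 1 by lra.
have cd : cos d = 1 - e / 2 by rewrite acosK ?in_itv.
have d0 : 0 < d by rewrite acos_gt0//; lra.
have dpi : d <= pi.
  exact: acos_lepi.
have pi0 := @pi_gt0 R.
have dIpi : d \in `[0, pi] by rewrite in_itv/= ltW.
have dpi2 : d <= pi / 2.
  have hI : pi / 2 \in `[0, pi : R] by rewrite in_itv/=; lra.
  by rewrite leNgt -(ltr_cos hI dIpi) cos_pihalf cd -leNgt; lra.
have pdI : pi - d \in `[0, pi] by rewrite in_itv/=; lra.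
have cpd : cos (pi - d) = - (1 - e / 2) by rewrite addrC cosDpi cosN cd.
pose h := Num.min 1 (k / 8).
have h0 : 0 < h by rewrite lt_min ltr01 divr_gt0.
have h1 : h <= 1 by rewrite ge_min lexx.
have hk : h <= k / 8 by rewrite ge_min lexx orbT.
have [M hM] := zero_spacing hJ hsum d0 dpi2 h0 h1.
exists (maxn M (Num.truncn (168 / k))).+1 => n E E'.
case: n => [//|n]; rewrite ltnS geq_max => /andP[Mn kn].
move=> [EI E'I rE rE' [EE' noz]].
have bulk x : x \in `[- 2 + eps, 2 - eps] ->
    [/\ d <= acos (x / 2), acos (x / 2) <= pi - d, x = 2 * cos (acos (x / 2))
      & acos (x / 2) \in `[0, pi]].
  rewrite in_itv/= => xI.
  have xI2 : -1 <= x / 2 <= 1 by apply/andP; split; lra.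
  have cx : cos (acos (x / 2)) = x / 2 by rewrite acosK ?in_itv.
  have tI : acos (x / 2) \in `[0, pi] by rewrite in_itv/= acos_ge0// acos_lepi.
  split => //; last by rewrite cx; lra.
  - by rewrite leNgt -(ltr_cos tI dIpi) cx cd -leNgt; lra.
  - by rewrite leNgt -(ltr_cos pdI tI) cx cpd -leNgt; lra.
have [dt td Et tI] := bulk E EI; have [dt' t'd Et' t'I] := bulk E' E'I.
move: (acos (E / 2)) (acos (E' / 2)) dt td Et tI dt' t'd Et' t'I => t t'.
move=> dt td Et tI dt' t'd Et' t'I {bulk}; subst E E'.
rewrite arcsine_pdf_inv; last by move: tI; rewrite in_itv.
have [w w1 wE] : exists2 w : R, 1 < w & w = n.+2%:R.
  by exists n.+2%:R => //; rewrite ltr1n.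
have small : 4 * h + 84 / w <= k.
  have : 168 / k < w.
    rewrite wE; apply: lt_le_trans (truncnS_gt _) _.
    by rewrite ler_nat ltnS (leq_trans kn).
  rewrite ltr_pdivrMr// => h3.
  have : 84 / w <= k / 2 by rewrite ler_pdivrMr; lra.
  by move: (84 / w) => q; clear hsum; lra.
have nE : n.+1%:R = w - 1 :> R by rewrite wE -(natr1 n.+1) addrK.
have st : 0 <= sin t by apply: sin_ge0_pi; move: tI; rewrite in_itv.
have [tt'|t't|tt'] := ltgtP t t'.
- have cc : cos t' < cos t by rewrite ltr_cos.
  rewrite [`|2 * cos t - _|]ger0_norm; last lra.
  rewrite nE; apply: le_trans small; apply: clock_gap => //.
    by rewrite lexx ltW.
  rewrite wE; apply: hM => //; [exact/rootP|exact/rootP|].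
  move=> z /andP[tz zt']; have zI : z \in `[0, pi].
    by move: tI t'I; rewrite !in_itv/=; lra.
  have c1 : cos t' < cos z by rewrite ltr_cos.
  have c2 : cos z < cos t by rewrite ltr_cos.
  by apply: noz; rewrite ?gt_min ?lt_max !ltr_pM2l// ?c1 ?c2 ?orbT.
- have cc : cos t < cos t' by rewrite ltr_cos.
  rewrite [`|2 * cos t - _|]distrC [`|2 * cos t' - _|]ger0_norm; last lra.
  rewrite nE; apply: le_trans small; apply: clock_gap => //.
    by rewrite lexx ltW.
  rewrite wE; apply: hM => //; [exact/rootP|exact/rootP|].
  move=> z /andP[tz zt']; have zI : z \in `[0, pi].
    by move: tI t'I; rewrite !in_itv/=; lra.
  have c1 : cos t < cos z by rewrite ltr_cos.
  have c2 : cos z < cos t' by rewrite ltr_cos.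
  by apply: noz; rewrite ?gt_min ?lt_max !ltr_pM2l// ?c1 ?c2 ?orbT.
- by rewrite tt' eqxx in EE'.
Qed.

Theorem theorem1p3 (R : realType) (a b : nat -> R)
    (hJ : jacobi_parameters a b)
    (hsum : (\sum_(1 <= n <oo) (`|a n - 1| + `|b n|)%:E < +oo)%E)
    (eps : R) (heps : 0 < eps) :
  uniform_clock a b (- 2 + eps) (2 - eps).
Proof.
have inside x : x \in `[- 2 + eps, 2 - eps] -> -2 < x < 2.
  by rewrite in_itv/=; lra.
exists arcsine_law, arcsine_pdf; split.
- exact: arcsine_density_of_states.
- by [].
- apply/continuous_in_subspaceT => x; rewrite inE => /inside.
  exact: continuous_arcsine_pdf.
- by move=> x /inside xI; rewrite invr_eq0 gt_eqF// arcsine_sqrt_gt0.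
- apply/cvgrPdist_le => k k0; have [N hN] := clock_spacing hJ hsum heps k0.
  exists N => // n /= Nn; rewrite sub0r normrN.
  set S := clock_deviations _ _ _ _ _ _.
  have Sk : ubound S k by move=> _ [E [E' [EE' ->]]]; exact: hN EE'.
  have [->|/set0P[x Sx]] := eqVneq S set0; first by rewrite sup0 normr0 ltW.
  rewrite ger0_norm; first by apply: ge_sup => //; exists x.
  have x0 : 0 <= x by case: Sx => [E [E' [_ ->]]].
  by apply: le_trans x0 _; apply: ub_le_sup => //; exists k.
Qed.
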